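(* Let $\mathbb{K}\in\{\mathbb{R},\mathbb{C}\}$, let $\mathcal{H}=\bigoplus_{n\in\mathbb{N}_0}\mathcal{H}_n$ be a graded Hopf algebra over $\mathbb{K}$ with $\dim\mathcal{H}_0<\infty$, and let $B$ be a commutative continuous inverse algebra over $\mathbb{K}$. Then the character group $\mathcal{G}(\mathcal{H},B)$ (with the topology of pointwise convergence) is a, in general infinite-dimensional, Lie group modelled on a locally convex space, whose Lie algebra is $\mathfrak{g}(\mathcal{H},B)$, the Lie algebra of infinitesimal characters with bracket $[\phi,\psi]=\phi\star\psi-\psi\star\phi$.
   Context: All algebras are unital and associative; all coalgebras are counital and coassociative. A Hopf algebra $(\mathcal{H},m_{\mathcal{H}},1_{\mathcal{H}},\Delta,\varepsilon_{\mathcal{H}},S)$ over $\mathbb{K}$ is a bialgebra equipped with an antiautomorphism $S$ (the antipode) satisfying $m_{\mathcal{H}}\circ(S\otimes\mathrm{id})\circ\Delta=\varepsilon_{\mathcal{H}}(\cdot)1_{\mathcal{H}}=m_{\mathcal{H}}\circ(\mathrm{id}\otimes S)\circ\Delta$. It is graded if $\mathcal{H}=\bigoplus_{n\in\mathbb{N}_0}\mathcal{H}_n$ with $\mathcal{H}_n\cdot\mathcal{H}_m\subseteq\mathcal{H}_{n+m}$ and $\Delta(\mathcal{H}_n)\subseteq\bigoplus_{k+l=n}\mathcal{H}_k\otimes\mathcal{H}_l$. A continuous inverse algebra (CIA) is a locally convex (Hausdorff) algebra with jointly continuous multiplication whose group of units is open and on whose unit group inversion is continuous. $A:=\mathrm{Hom}_{\mathbb{K}}(\mathcal{H},B)$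 is the space of $\mathbb{K}$-linear maps with the topology of pointwise convergence and the convolution product $\phi\star\psi=m_B\circ(\phi\otimes\psi)\circ\Delta$, with unit $1_A=\varepsilon_{\mathcal{H}}(\cdot)1_B$. $\mathcal{G}(\mathcal{H},B)\subseteq A$ is the set of characters, i.e. linear maps $\phi$ with $\phi(ab)=\phi(a)\phi(b)$ for all $a,b\in\mathcal{H}$ and $\phi(1_{\mathcal{H}})=1_B$; it is a group under $\star$ with inverse $\phi\mapsto\phi\circ S$. $\mathfrak{g}(\mathcal{H},B)\subseteq A$ is the set of infinitesimal characters, i.e. linear maps $\phi$ with $\phi(ab)=\varepsilon_{\mathcal{H}}(b)\phi(a)+\varepsilon_{\mathcal{H}}(a)\phi(b)$ for all $a,b$. Both carry the subspace topology. Differentiability is in the sense of Bastiani: a map $f:U\to F$ from an open subset $U$ of a locally convex $\mathbb{K}$-space $E$ to a locally convex $\mathbb{K}$-space $F$ is $C^r_{\mathbb{K}}$ if all iterated directional derivatives $d^{(k)}f(x,y_1,\dots,y_k)=(D_{y_k}\cdots D_{y_1}f)(x)$, $k\in\mathbb{N}_0$, $k\le r$, exist and define continuous maps $U\times E^k\to F$. A Lie group is a group with a $C^\infty_{\mathbb{K}}$-manifold structure (Hausdorff, modelled on a locally convex space) whose group operations are smooth. The Lie algebra of $\mathcal{G}(\mathcal{H},B)$ is its tangent space at the identity $1_A$, regarded as a subspace of $A=T_{1_A}A^\times$, where $A^\times$ is the (open) unit group of $A$. *)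

(* Defs.v *)
From HB Require Import structures.
From mathcomp Require Import all_boot all_order all_algebra.
From mathcomp Require Import complex.
From mathcomp Require Import all_classical all_reals all_analysis.

Set Implicit Arguments.
Unset Strict Implicit.
Unset Printing Implicit Defensive.

Import Order.TTheory GRing.Theory Num.Theory.

Local Open Scope classical_set_scope.
Local Open Scope quotient_scope.
Local Open Scope ring_scope.

(* Elements of the tensor product are finite formal sums of pairs, two sums    *)
(* being identified when no bilinear map into a K-module separates them; this  *)
(* is the quotient of the free module by the bilinearity relations.            *)
Section Tensor.
Context (K : comNzRingType) (U V : lmodType K).

Definition bilinear_map (W : lmodType K) (f : U -> V -> W) :=
  (forall v, linear (f^~ v)) /\ (forall u, linear (f u)).

Definition tsum (W : lmodType K) (f : U -> V -> W) (s : seq (U * V)) : W :=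
  \sum_(p <- s) f p.1 p.2.

Definition tequiv (s t : seq (U * V)) : bool :=
  `[< forall (W : lmodType K) (f : U -> V -> W),
        bilinear_map f -> tsum f s = tsum f t >].

Lemma tequiv_refl : reflexive tequiv.
Proof. by move=> s; apply/asboolP. Qed.

Lemma tequiv_sym : symmetric tequiv.
Proof.
by move=> s t; apply/asboolP/asboolP => h W f hf; rewrite h.
Qed.

Lemma tequiv_trans : transitive tequiv.
Proof.
move=> t s r /asboolP h1 /asboolP h2; apply/asboolP => W f hf.
by rewrite h1 // h2.
Qed.

Canonical tequiv_equiv : equiv_rel (seq (U * V)) :=
  EquivRel tequiv tequiv_refl tequiv_sym tequiv_trans.

Definition tensor : Type := {eq_quot tequiv}.

HB.instance Definition _ : Choice tensor := Choice.on tensor.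

Definition tclass (s : seq (U * V)) : tensor := \pi_({eq_quot tequiv}) s.
Definition trepr (x : tensor) : seq (U * V) := repr (x : {eq_quot tequiv}).

Definition tens (u : U) (v : V) : tensor := tclass [:: (u, v)].

(* The linear map induced by f; only meaningful when f is bilinear. *)
Definition tlift (W : lmodType K) (f : U -> V -> W) (x : tensor) : W :=
  tsum f (trepr x).

Lemma tlift_class (W : lmodType K) (f : U -> V -> W) s :
  bilinear_map f -> tlift f (tclass s) = tsum f s.
Proof.
move=> hf; rewrite /tlift /trepr /tclass.
have : repr (\pi_({eq_quot tequiv}) s) == s %[mod {eq_quot tequiv}].
  by rewrite reprK.
by rewrite eqmodE => /asboolP; apply.
Qed.

Lemma tensorP (x y : tensor) :
  (forall (W : lmodType K) (f : U -> V -> W),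
     bilinear_map f -> tlift f x = tlift f y) -> x = y.
Proof.
move=> h; rewrite -[x](@reprK _ {eq_quot tequiv}) -[y](@reprK _ {eq_quot tequiv}).
apply/eqP; rewrite eqmodE; apply/asboolP => W f hf; exact: h.
Qed.

Definition tadd (x y : tensor) := tclass (trepr x ++ trepr y).
Definition tscale (k : K) (x : tensor) :=
  tclass [seq (k *: p.1, p.2) | p <- trepr x].
Definition topp (x : tensor) := tscale (-1) x.
Definition tzero := tclass [::].

Lemma tlift_add (W : lmodType K) (f : U -> V -> W) x y : bilinear_map f ->
  tlift f (tadd x y) = tlift f x + tlift f y.
Proof. by move=> hf; rewrite tlift_class // /tsum big_cat. Qed.

Lemma tlift_scale (W : lmodType K) (f : U -> V -> W) k x : bilinear_map f ->
  tlift f (tscale k x) = k *: tlift f x.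
Proof.
move=> hf; rewrite tlift_class // /tlift /tsum big_map scaler_sumr.
apply: eq_bigr => p _; case: hf => /(_ p.2) h _.
have := h k p.1 0; have := h 1 0 0; rewrite !addr0 !scale1r.
by rewrite -{1}[f 0 _]addr0 => /addrI <-; rewrite addr0.
Qed.

Lemma tlift_zero (W : lmodType K) (f : U -> V -> W) : bilinear_map f ->
  tlift f tzero = 0.
Proof. by move=> hf; rewrite tlift_class // /tsum big_nil. Qed.

Ltac tensor_law := move=> *; apply: tensorP => W f hf;
  rewrite /topp ?(tlift_add, tlift_scale, tlift_zero) //.

Fact taddA : associative tadd. Proof. by tensor_law; rewrite addrA. Qed.
Fact taddC : commutative tadd. Proof. by tensor_law; rewrite addrC. Qed.
Fact tadd0 : left_id tzero tadd. Proof. by tensor_law; rewrite add0r. Qed.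
Fact taddN : left_inverse tzero topp tadd.
Proof. by tensor_law; rewrite scaleN1r addNr. Qed.

HB.instance Definition _ := GRing.isZmodule.Build tensor taddA taddC tadd0 taddN.

Fact tscaleA a b x : tscale a (tscale b x) = tscale (a * b) x.
Proof. by tensor_law; rewrite scalerA. Qed.
Fact tscale1 : left_id 1 tscale. Proof. by tensor_law; rewrite scale1r. Qed.
Fact tscaleDr : right_distributive tscale tadd.
Proof. by tensor_law; rewrite scalerDr. Qed.
Fact tscaleDl x : {morph tscale^~ x : a b / a + b >-> tadd a b}.
Proof. by tensor_law; rewrite scalerDl. Qed.

HB.instance Definition _ := GRing.Zmodule_isLmodule.Build K tensor
  tscaleA tscale1 tscaleDr tscaleDl.

Lemma tlift_linear (W : lmodType K) (f : U -> V -> W) :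
  bilinear_map f -> linear (tlift f).
Proof. by move=> hf k x y; rewrite tlift_add // tlift_scale. Qed.

Lemma tlift_sum (W : lmodType K) (f : U -> V -> W) (I : Type) (r : seq I)
    (x : I -> tensor) : bilinear_map f ->
  tlift f (\sum_(i <- r) x i) = \sum_(i <- r) tlift f (x i).
Proof.
move=> hf; elim: r => [|i r ih]; first by rewrite !big_nil tlift_zero.
by rewrite !big_cons tlift_add // ih.
Qed.

Lemma tlift_tens (W : lmodType K) (f : U -> V -> W) u v :
  bilinear_map f -> tlift f (tens u v) = f u v.
Proof. by move=> hf; rewrite tlift_class // /tsum big_seq1. Qed.

Lemma tens_bilinear : bilinear_map tens.
Proof.
split=> [v|u] k x y; apply: tensorP => W f hf; have [h1 h2] := hf;
  by rewrite (tlift_linear hf) !tlift_tens // ?h1 ?h2.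
Qed.

Lemma tensorE x : x = \sum_(p <- trepr x) tens p.1 p.2.
Proof.
apply: tensorP => W f hf; rewrite {1}/tlift /tsum.
elim: (trepr x) => [|p s ih]; first by rewrite !big_nil tlift_zero.
by rewrite !big_cons [RHS]tlift_add // -ih tlift_tens.
Qed.

End Tensor.

Notation "U '⊗' V" := (tensor U V) (at level 39, left associativity) : type_scope.
Notation "u '⊗t' v" := (tens u v) (at level 39, left associativity) : ring_scope.

Section TensorMaps.
Context (K : comNzRingType).

Definition tmap (U U' V V' : lmodType K) (f : U -> U') (g : V -> V') :
    U ⊗ V -> U' ⊗ V' :=
  tlift (fun u v => f u ⊗t g v).

Definition tassoc (U V W : lmodType K) : (U ⊗ V) ⊗ W -> U ⊗ (V ⊗ W) :=
  tlift (fun x w => tlift (fun u v => u ⊗t (v ⊗t w)) x).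

Definition tmul (A : algType K) (x y : A ⊗ A) : A ⊗ A :=
  tlift (fun a b => tlift (fun c d => (a * c) ⊗t (b * d)) y) x.

End TensorMaps.

(* Since counit 1 = 1, the underlying ring is automatically nonzero, so that   *)
(* nothing is lost by using algType, whose rings satisfy 1 != 0.               *)
Record hopfAlgType (K : fieldType) := HopfAlgebra {
  hopf_sort :> algType K;
  comul : {linear hopf_sort -> hopf_sort ⊗ hopf_sort};
  counit : {linear hopf_sort -> K^o};
  antipode : {linear hopf_sort -> hopf_sort};
  comulA : forall x, tassoc (tmap comul idfun (comul x))
                     = tmap idfun comul (comul x);
  counitl : forall x, tlift (fun a b => counit a *: b) (comul x) = x;
  counitr : forall x, tlift (fun a b => counit b *: a) (comul x) = x;
  comulM : forall x y, comul (x * y) = tmul (comul x) (comul y);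
  comul1 : comul 1 = 1 ⊗t 1;
  counitM : forall x y, counit (x * y) = counit x * counit y;
  counit1 : counit 1 = 1;
  antipodel : forall x,
    tlift (fun a b => antipode a * b) (comul x) = (counit x)%:A;
  antipoder : forall x,
    tlift (fun a b => a * antipode b) (comul x) = (counit x)%:A;
  antipodeM : forall x y, antipode (x * y) = antipode y * antipode x;
  antipode1 : antipode 1 = 1;
  antipode_bij : bijective antipode
}.

Section Graded.
Context (K : fieldType).

Definition subspace_set (V : lmodType K) (P : set V) :=
  P 0 /\ forall (k : K) x y, P x -> P y -> P (k *: x + y).

Definition finite_dim (V : lmodType K) (P : set V) :=
  exists s : seq V, (forall v, v \in s -> P v) /\
    forall x, P x -> exists c : nat -> K, x = \sum_(i < size s) c i *: s`_i.

(* V is the internal direct sum of the subspaces P n. *)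
Definition direct_decomposition (V : lmodType K) (P : nat -> set V) :=
  [/\ forall n, subspace_set (P n),
      forall x, exists (N : nat) (y : nat -> V),
        (forall n, P n (y n)) /\ x = \sum_(n < N) y n
    & forall (N : nat) (y : nat -> V), (forall n, P n (y n)) ->
        \sum_(n < N) y n = 0 -> forall n, (n < N)%N -> y n = 0].

(* The sum of the images of P k ⊗ P l in V ⊗ V over all k + l = n. *)
Definition tensor_degree (V : lmodType K) (P : nat -> set V) (n : nat) :
    set (V ⊗ V) :=
  [set x | exists s : seq (V * V),
     (forall p, p \in s ->
        exists k l, [/\ (k + l)%N = n, P k p.1 & P l p.2]) /\
     x = \sum_(p <- s) p.1 ⊗t p.2].

Definition hopf_grading (H : hopfAlgType K) (P : nat -> set H) :=
  [/\ direct_decomposition P,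
      forall n m x y, P n x -> P m y -> P (n + m)%N (x * y)
    & forall n x, P n x -> tensor_degree P n (comul H x)].

End Graded.

Section Units.
Context (R : pzRingType).

Definition ring_units : set R := [set x | exists y, x * y = 1 /\ y * x = 1].

Definition ring_inv (x : R) : R := xget 0 [set y | x * y = 1 /\ y * x = 1].

End Units.

(* The multiplication is a field of the record, rather than inherited from     *)
(* algType, so that the zero algebra is allowed.                               *)
Record topAlgType (K : numFieldType) := TopAlgebra {
  topalg_tvs : tvsType K;
  topalg_mul : topalg_tvs -> topalg_tvs -> topalg_tvs;
  topalg_one : topalg_tvs;
  topalg_mulA : associative topalg_mul;
  topalg_mul1 : left_id topalg_one topalg_mul;
  topalg_mulr1 : right_id topalg_one topalg_mul;
  topalg_mulDl : left_distributive topalg_mul +%R;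
  topalg_mulDr : right_distributive topalg_mul +%R;
  topalg_scaleAl : forall (k : K) x y,
    k *: topalg_mul x y = topalg_mul (k *: x) y;
  topalg_scaleAr : forall (k : K) x y,
    k *: topalg_mul x y = topalg_mul x (k *: y);
  topalg_mul_continuous : continuous (fun p => topalg_mul p.1 p.2)
}.

Definition topalg_sort (K : numFieldType) (B : topAlgType K) : Type :=
  topalg_tvs B.
Coercion topalg_sort : topAlgType >-> Sortclass.

HB.instance Definition _ (K : numFieldType) (B : topAlgType K) :=
  Tvs.on (topalg_sort B).
HB.instance Definition _ (K : numFieldType) (B : topAlgType K) :=
  GRing.Zmodule_isPzRing.Build (topalg_sort B) (@topalg_mulA K B)
    (@topalg_mul1 K B) (@topalg_mulr1 K B) (@topalg_mulDl K B)
    (@topalg_mulDr K B).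

Lemma topalg_scalerAl (K : numFieldType) (B : topAlgType K) (k : K) (x y : B) :
  k *: (x * y) = (k *: x) * y.
Proof. exact: topalg_scaleAl. Qed.

Lemma topalg_scalerAr (K : numFieldType) (B : topAlgType K) (k : K) (x y : B) :
  k *: (x * y) = x * (k *: y).
Proof. exact: topalg_scaleAr. Qed.

(* A locally convex algebra is a tvsType, local convexity being part of the    *)
(* latter, with a jointly continuous multiplication.                           *)
Record ciaType (K : numFieldType) := ContinuousInverseAlgebra {
  cia_topalg :> topAlgType K;
  cia_hausdorff : hausdorff_space cia_topalg;
  cia_units_open : open (@ring_units cia_topalg);
  cia_inv_continuous :
    {within @ring_units cia_topalg, continuous (@ring_inv cia_topalg)}
}.

Record comCiaType (K : numFieldType) := ComContinuousInverseAlgebra {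
  comcia_cia :> ciaType K;
  comcia_mulC : commutative (@GRing.mul comcia_cia)
}.

HB.instance Definition _ (K : numFieldType) (B : comCiaType K) :=
  GRing.PzRing_hasCommutativeMul.Build (topalg_sort B) (@comcia_mulC K B).

(* Hom_K(H, B) as a subspace of the product H -> B, hence with the topology of *)
(* pointwise convergence.                                                      *)
Section HomSpace.
Context (K : numFieldType) (H : lmodType K) (B : topAlgType K).

Definition homSpace : Type := set_type [set f : {ptws H -> B} | linear f].

HB.instance Definition _ := Topological.on homSpace.

Definition hom_fun (f : homSpace) : H -> B := set_val f.
Coercion hom_fun : homSpace >-> Funclass.

Lemma hom_linear (f : homSpace) : linear f.
Proof. by case: f => f hf; exact: (set_mem hf). Qed.

Lemma homP (f g : homSpace) : f =1 g -> f = g.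
Proof. by move=> h; apply: val_inj; apply/funext. Qed.

Definition mkHom (f : H -> B) (hf : linear f) : homSpace :=
  exist _ (f : {ptws H -> B}) (mem_set hf).

Fact hom_zero_linear : linear (fun _ : H => 0 : B).
Proof. by move=> k x y; rewrite scaler0 addr0. Qed.
Fact hom_add_linear (f g : homSpace) : linear (fun x => f x + g x).
Proof. by move=> k x y; rewrite !hom_linear scalerDr addrACA. Qed.
Fact hom_scale_linear (c : K) (f : homSpace) : linear (fun x => c *: f x).
Proof.
by move=> k x y; rewrite hom_linear scalerDr !scalerA mulrC.
Qed.

Definition hom_zero := mkHom hom_zero_linear.
Definition hom_add f g := mkHom (hom_add_linear f g).
Definition hom_scale c f := mkHom (hom_scale_linear c f).
Definition hom_opp f := hom_scale (-1) f.

Fact hom_addA : associative hom_add.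
Proof. by move=> f g h; apply: homP => x; exact: addrA. Qed.
Fact hom_addC : commutative hom_add.
Proof. by move=> f g; apply: homP => x; exact: addrC. Qed.
Fact hom_add0 : left_id hom_zero hom_add.
Proof. by move=> f; apply: homP => x; exact: add0r. Qed.
Fact hom_addN : left_inverse hom_zero hom_opp hom_add.
Proof.
move=> f; apply: homP => x; change (-1 *: f x + f x = 0 :> B).
by rewrite scaleN1r addNr.
Qed.

HB.instance Definition _ :=
  GRing.isZmodule.Build homSpace hom_addA hom_addC hom_add0 hom_addN.

Fact hom_scaleA a b f : hom_scale a (hom_scale b f) = hom_scale (a * b) f.
Proof. by apply: homP => x; exact: scalerA. Qed.
Fact hom_scale1 : left_id 1 hom_scale.
Proof. by move=> f; apply: homP => x; exact: scale1r. Qed.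
Fact hom_scaleDr : right_distributive hom_scale hom_add.
Proof. by move=> k f g; apply: homP => x; exact: scalerDr. Qed.
Fact hom_scaleDl f : {morph hom_scale^~ f : a b / a + b >-> hom_add a b}.
Proof. by move=> a b; apply: homP => x; exact: scalerDl. Qed.

HB.instance Definition _ := GRing.Zmodule_isLmodule.Build K homSpace
  hom_scaleA hom_scale1 hom_scaleDr hom_scaleDl.

Lemma hom_eval_continuous x : continuous (fun f : homSpace => f x).
Proof.
move=> f O nO.
exact: (@initial_continuous homSpace {ptws H -> B} set_val f _
          (@proj_continuous H (fun=> B) x (set_val f) O nO)).
Qed.

Lemma hom_cvgP (F : set_system homSpace) (f : homSpace) : Filter F ->
  (F --> f) <-> (forall x, (fun g : homSpace => g x) @ F --> f x).
Proof.
move=> FF; split=> [h x|h].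
  exact: cvg_trans (cvg_app _ h) (@hom_eval_continuous x f).
suff : (set_val : homSpace -> {ptws H -> B}) @ F --> set_val f.
  move=> hv U [_ [[P oP <-] Pf] PU]; apply: filterS PU _.
  by apply: hv; exact: open_nbhs_nbhs.
apply/cvg_sup => x U [_ [[P oP <-] Pf] PU].
apply: (@filterS _ F _ ((fun g : homSpace => g x) @^-1` P)) => [g Pg|].
  exact: PU.
by apply: h; exact: open_nbhs_nbhs.
Qed.

Fact hom_add_continuous : continuous (fun p : homSpace * homSpace => p.1 + p.2).
Proof.
move=> p; apply/hom_cvgP => x.
pose f := fun q : homSpace * homSpace => hom_fun q.1 x.
pose g := fun q : homSpace * homSpace => hom_fun q.2 x.
have hf : f @ nbhs p --> f p.
  apply: (@cvg_comp _ _ _ _ (fun h : homSpace => h x) _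
            (nbhs (p.1 : homSpace))); first exact: cvg_fst.
  exact: hom_eval_continuous.
have hg : g @ nbhs p --> g p.
  apply: (@cvg_comp _ _ _ _ (fun h : homSpace => h x) _
            (nbhs (p.2 : homSpace))); first exact: cvg_snd.
  exact: hom_eval_continuous.
exact: (continuous2_cvg _ (@add_continuous B (f p, g p)) hf hg).
Qed.

Fact hom_scale_continuous : continuous (fun p : K^o * homSpace => p.1 *: p.2).
Proof.
move=> p; apply/hom_cvgP => x.
pose g := fun q : K^o * homSpace => hom_fun q.2 x.
have hf : fst @ nbhs p --> p.1 by exact: cvg_fst.
have hg : g @ nbhs p --> g p.
  apply: (@cvg_comp _ _ _ _ (fun h : homSpace => h x) _
            (nbhs (p.2 : homSpace))); first exact: cvg_snd.
  exact: hom_eval_continuous.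
exact: (continuous2_cvg _ (@scale_continuous K B (p.1, g p)) hf hg).
Qed.

Fact hom_locally_convex : exists2 S : set_system homSpace,
  (forall b, b \in S -> convex_set b) & basis S.
Proof.
exists [set S | open S /\ convex_set S] => [b /set_mem []//|].
split=> [S []//|f].
have [Bs Bsc [Bso Bsb]] := @locally_convex K B.
apply/hom_cvgP.
  apply: filter_from_filter.
    exists setT; split=> //; split; first exact: openT.
    by move=> x y l _ _; rewrite inE.
  move=> S T [[oS cS] Sf] [[oT cT] Tf]; exists (S `&` T) => //.
  split; last by [].
  split; first exact: openI.
  move=> x y l; rewrite !in_setI => /andP[xS xT] /andP[yS yT].
  by rewrite cS // cT.
move=> x V /Bsb [b [Bb bfx] bV].
exists ((fun g : homSpace => g x) @^-1` b); last by move=> g; exact: bV.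
split=> //; split.
  apply: open_comp; last exact: Bso.
  by move=> g _; exact: hom_eval_continuous.
move=> g h l; rewrite !inE => bg bh.
have := Bsc b (mem_set Bb) (hom_fun g x) (hom_fun h x) l; rewrite !inE; exact.
Qed.

HB.instance Definition _ := PreTopologicalLmod_isTvs.Build K homSpace
  hom_add_continuous hom_scale_continuous hom_locally_convex.
HB.instance Definition _ :=
  PreTopologicalNmodule_isTopologicalNmodule.Build homSpace hom_add_continuous.
HB.instance Definition _ :=
  TopologicalNmodule_isTopologicalLmodule.Build K homSpace hom_scale_continuous.
HB.instance Definition _ := Uniform_isTvs.Build K homSpace hom_locally_convex.

End HomSpace.

Section Characters.
Context (K : numFieldType) (H : hopfAlgType K) (B : comCiaType K).

Local Notation A := (homSpace H B).

Definition characters : set A :=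
  [set phi | (forall a b, phi (a * b) = phi a * phi b) /\ phi 1 = 1].

Definition inf_characters : set A :=
  [set phi | forall a b,
     phi (a * b) = counit H b *: phi a + counit H a *: phi b].

Fact conv_bilinear (phi psi : A) : bilinear_map (fun a b => phi a * psi b).
Proof.
split=> [b|a] k x y.
  by rewrite hom_linear mulrDl topalg_scalerAl.
by rewrite hom_linear mulrDr topalg_scalerAr.
Qed.

Fact conv_linear (phi psi : A) :
  linear (fun x => tlift (fun a b => phi a * psi b) (comul H x)).
Proof.
by move=> k x y; rewrite linearP (tlift_linear (conv_bilinear phi psi)).
Qed.

Definition conv (phi psi : A) : A := mkHom (conv_linear phi psi).

Lemma convE (phi psi : A) x :
  conv phi psi x = tlift (fun a b => phi a * psi b) (comul H x).
Proof. by []. Qed.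

Fact conv_one_linear : linear (fun x : H => counit H x *: (1 : B)).
Proof. by move=> k x y; rewrite linearP scalerDl scalerA. Qed.

Definition conv_one : A := mkHom conv_one_linear.

Lemma conv_oneE x : conv_one x = counit H x *: (1 : B).
Proof. by []. Qed.

Fact conv_characters (phi psi : A) :
  characters phi -> characters psi -> characters (conv phi psi).
Proof.
move=> [phiM phi1] [psiM psi1]; have hb := conv_bilinear phi psi.
split=> [a b|]; rewrite !convE; last first.
  by rewrite comul1 tlift_tens // phi1 psi1 mulr1.
rewrite comulM /tmul {2}/tlift /tsum tlift_sum //.
rewrite {3}/tlift /tsum mulr_suml; apply: eq_bigr => p _.
rewrite {2}/tlift /tsum tlift_sum // {2}/tlift /tsum mulr_sumr.
apply: eq_bigr => q _.
by rewrite tlift_tens // phiM psiM mulrACA.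
Qed.

Fact conv_one_characters : characters conv_one.
Proof.
split=> [a b|]; rewrite !conv_oneE; last by rewrite counit1 scale1r.
by rewrite counitM -topalg_scalerAl mul1r scalerA.
Qed.

Fact inv_linear (phi : A) : linear (fun x => phi (antipode H x)).
Proof. by move=> k x y; rewrite linearP hom_linear. Qed.

Definition conv_inv (phi : A) : A := mkHom (inv_linear phi).

Lemma conv_invE (phi : A) x : conv_inv phi x = phi (antipode H x).
Proof. by []. Qed.

Fact inv_characters (phi : A) : characters phi -> characters (conv_inv phi).
Proof.
move=> [phiM phi1]; split=> [a b|]; rewrite !conv_invE.
  by rewrite antipodeM phiM mulrC.
by rewrite antipode1 phi1.
Qed.

Definition charGroup : Type := set_type characters.

HB.instance Definition _ := Topological.on charGroup.

Definition char_val (phi : charGroup) : A := set_val phi.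

Definition char_mul (phi psi : charGroup) : charGroup :=
  exist _ (conv (char_val phi) (char_val psi))
    (mem_set (conv_characters (set_mem (valP phi)) (set_mem (valP psi)))).

Definition char_one : charGroup := exist _ conv_one (mem_set conv_one_characters).

Definition char_inv (phi : charGroup) : charGroup :=
  exist _ (conv_inv (char_val phi))
    (mem_set (inv_characters (set_mem (valP phi)))).

Definition conv_bracket (phi psi : A) : A := conv phi psi - conv psi phi.

End Characters.

(* Bastiani calculus. Maps are total functions, of which only the values on    *)
(* the open set U matter.                                                      *)
Section Bastiani.
Context (K : numFieldType) (E F : tvsType K).

Definition is_dderiv (f : E -> F) (x v : E) (l : F) : Prop :=
  (fun h : K^o => (h : K)^-1 *: (f (x + (h : K) *: v) - f x)) @ (0 : K^o)^' --> l.

Definition dderiv (f : E -> F) (v x : E) : F := xget 0 [set l | is_dderiv f x v l].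

(* iter_dderiv f [:: y_1; ...; y_k] is D_{y_k} ... D_{y_1} f. *)
Definition iter_dderiv (f : E -> F) (ys : seq E) : E -> F := foldl dderiv f ys.

(* The differential d^(k) f, as a function on E * E^k. *)
Definition iter_diff (k : nat) (f : E -> F) (p : E * {ptws 'I_k -> E}) : F :=
  iter_dderiv f [seq p.2 i | i <- enum 'I_k] p.1.

Definition smooth_on (U : set E) (f : E -> F) : Prop :=
  [/\ open U,
      forall (ys : seq E) (x v : E), U x ->
        exists l, is_dderiv (iter_dderiv f ys) x v l
    & forall (k : nat) (x : E) (ys : {ptws 'I_k -> E}), U x ->
        {for (x, ys), continuous (iter_diff f : E * {ptws 'I_k -> E} -> F)}].

End Bastiani.

Record chart (M : topologicalType) (E : Type) := Chart {
  chart_dom : set M;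
  chart_cod : set E;
  chart_fun : M -> E;
  chart_inv : E -> M
}.

Section Manifolds.
Context (K : numFieldType).

Definition is_chart (M : topologicalType) (E : tvsType K) (c : chart M E) :=
  [/\ open (chart_dom c) /\ open (chart_cod c),
      (forall x, chart_dom c x -> chart_cod c (chart_fun c x)) /\
      (forall y, chart_cod c y -> chart_dom c (chart_inv c y)),
      {in chart_dom c, cancel (chart_fun c) (chart_inv c)} /\
      {in chart_cod c, cancel (chart_inv c) (chart_fun c)},
      {within chart_dom c, continuous (chart_fun c)}
    & {within chart_cod c, continuous (chart_inv c)}].

Definition local_rep (M N : topologicalType) (E F : Type)
    (c : chart M E) (d : chart N F) (f : M -> N) : E -> F :=
  fun y => chart_fun d (f (chart_inv c y)).

Definition local_dom (M N : topologicalType) (E F : Type)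
    (c : chart M E) (d : chart N F) (f : M -> N) : set E :=
  [set y | chart_cod c y /\ chart_dom d (f (chart_inv c y))].

Definition smooth_atlas (M : topologicalType) (E : tvsType K)
    (At : set (chart M E)) : Prop :=
  [/\ forall c, At c -> is_chart c,
      forall x, exists2 c, At c & chart_dom c x
    & forall c d, At c -> At d -> smooth_on (local_dom c d id) (local_rep c d id)].

Definition smooth_map (M N : topologicalType) (E F : tvsType K)
    (At : set (chart M E)) (Bt : set (chart N F)) (f : M -> N) : Prop :=
  continuous f /\
  forall c d, At c -> Bt d -> smooth_on (local_dom c d f) (local_rep c d f).

Definition prod_chart (M N : topologicalType) (E F : Type)
    (c : chart M E) (d : chart N F) : chart (M * N)%type (E * F) :=
  Chart (M := (M * N)%type) (chart_dom c `*` chart_dom d)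
    (chart_cod c `*` chart_cod d)
    (fun p => (chart_fun c p.1, chart_fun d p.2))
    (fun p => (chart_inv c p.1, chart_inv d p.2)).

Definition prod_atlas (M N : topologicalType) (E F : Type)
    (At : set (chart M E)) (Bt : set (chart N F)) :
    set (chart (M * N)%type (E * F)) :=
  [set e | exists c d, [/\ At c, Bt d & e = prod_chart c d]].

Definition vector_chart (F : tvsType K) : chart F F := Chart setT setT id id.

Definition is_lie_group (G : topologicalType) (mul : G -> G -> G) (one : G)
    (inv : G -> G) (E : tvsType K) (At : set (chart G E)) : Prop :=
  [/\ [/\ associative mul, left_id one mul & left_inverse one inv mul],
      hausdorff_space E /\ hausdorff_space G,
      smooth_atlas At,
      smooth_map (prod_atlas At At) At (fun p : G * G => mul p.1 p.2)
    & smooth_map At At inv].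

(* The Lie bracket of vector fields, given by their local representatives. *)
Definition vf_bracket (E : tvsType K) (X Y : E -> E) : E -> E :=
  fun x => dderiv Y (X x) x - dderiv X (Y x) x.

(* The local representative, in a chart c around the identity, of the          *)
(* left-invariant vector field x |-> T_1(lambda_x) v, where lambda_x is the    *)
(* left translation by x.                                                      *)
Definition left_invariant_vf (G : topologicalType) (mul : G -> G -> G)
    (one : G) (E : tvsType K) (c : chart G E) (v : E) : E -> E :=
  fun x => dderiv (local_rep c c (mul (chart_inv c x))) v (chart_fun c one).

(* The bracket on the tangent space at the identity, which the chart c         *)
(* identifies with E.                                                          *)
Definition lie_bracket (G : topologicalType) (mul : G -> G -> G)
    (one : G) (E : tvsType K) (c : chart G E) (v w : E) : E :=
  vf_bracket (left_invariant_vf mul one c v) (left_invariant_vf mul one c w)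
    (chart_fun c one).

(* The tangent map at x of f : M -> F, where the chart c around x identifies   *)
(* the tangent space of M at x with E.                                         *)
Definition tangent_map (M : topologicalType) (E F : tvsType K)
    (c : chart M E) (f : M -> F) (x : M) : E -> F :=
  fun v => dderiv (local_rep c (vector_chart F) f) v (chart_fun c x).

(* The smooth map f into the locally convex space F induces an isomorphism of  *)
(* topological Lie algebras from the tangent space of G at the identity onto   *)
(* the subspace g of F with bracket br.                                        *)
Definition lie_algebra_via (G : topologicalType) (mul : G -> G -> G) (one : G)
    (E F : tvsType K) (At : set (chart G E)) (f : G -> F)
    (g : set F) (br : F -> F -> F) : Prop :=
  smooth_map At [set vector_chart F] f /\
  forall c, At c -> chart_dom c one ->
    let T := tangent_map c f one in
    [/\ linear T,
        set_bij setT g T,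
        forall U : set E, open U <-> exists2 W : set F, open W & U = T @^-1` W
      & forall v w, T (lie_bracket mul one c v w) = br (T v) (T w)].

End Manifolds.

(* Main.v *)
Require Import Defs.
From HB Require Import structures.
From mathcomp Require Import all_boot all_order all_algebra.
From mathcomp Require Import complex ring.
From mathcomp Require Import all_classical all_reals all_analysis.

Set Implicit Arguments.
Unset Strict Implicit.
Unset Printing Implicit Defensive.

Import Order.TTheory GRing.Theory Num.Theory.

Local Open Scope classical_set_scope.
Local Open Scope ring_scope.

(** Write A for Hom(H, B) with the convolution product, and F_n for the set of
    those x in A that vanish on H_0, ..., H_{n-1}.  Since the coproduct respects
    degrees, F_m F_n is contained in F_{m+n}, and A is complete for this
    filtration because each element of H has finite degree.  Hence the
    exponential series converges on F_1, and exp is a bijection from F_1 onto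
    1 + F_1: its inverse is obtained by correcting an approximate logarithm x of
    phi to x + (phi - exp x), which gains one degree at each step (expoD,
    logoK).  The values of exp x and of its inverse at a given element of H are
    polynomials in finitely many values of x, and this is what makes all the
    maps below smooth.

    On F_1, exp restricts to a bijection between infinitesimal characters and
    characters.  One direction is the Leibniz rule for convolution powers
    (expo_char).  Conversely, if exp x is a character, then so is
    exp (2^i x) = (exp x)^(2^i) for every i; both sides of its multiplicativity
    at (a, b) are polynomials in 2^i, and comparing the linear coefficients
    shows that x is an infinitesimal character (char_expo_inf).

    It remains to see that F_1 captures everything near the identity, and this
    is where the dimension of H_0 matters.  Let I_0 be the kernel of the counit
    on H_0.  Then I_0 = I_0 I_0.  Otherwise there is an a in I_0 and a scalar
    infinitesimal character y with y(a) = 1; then y^m(a^m) = m! while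
    y^k(a^m) = 0 for k < m, so the powers of a are linearly independent, which
    is impossible in H_0 (hom0_aug_square).  Consequently every infinitesimal
    character vanishes on H_0, hence lies in F_1.  Moreover, if t_1, ..., t_d
    span I_0 then t_i = sum_j r_ij t_j with r_ij in I_0, so a character phi
    satisfies (1 - (phi(r_ij))) (phi(t_j)) = 0.  When phi is close to the
    counit, the determinant of this matrix is close to 1 and therefore
    invertible, because the units of B are open, and phi coincides with the
    counit on H_0 (char_near_one).  Thus the characters in 1 + F_1 form an open
    normal subgroup.

    The logarithm of g^-1 phi is then a chart on the coset of g modulo this
    subgroup, with values in the space of infinitesimal characters.  In such
    charts, the domains of the local representatives of the group operations
    are empty or the whole space, and the representatives are polynomial in each
    evaluation (smooth_log_rep).  The tangent map of the inclusion at the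
    identity is the derivative of exp at 0, that is the inclusion of
    infinitesimal characters into A.  For the bracket, let Y_w be the
    left-invariant vector field of w in the logarithmic chart.  Differentiating
    exp (log (exp x exp (t w))) = exp x exp (t w) in t gives
    d exp_x (Y_w(x)) = exp x w, and differentiating again at x = 0 in direction
    v gives d Y_w(0)(v) = v w - (v w + w v) / 2; antisymmetrizing leaves the
    commutator (livf_dderiv). *)

(** * Linear maps and maps out of a tensor product *)

Section LinearMaps.
Context (K : pzRingType) (V W : lmodType K) (f : V -> W) (hf : linear f).

Lemma lin0 : f 0 = 0.
Proof. by have := hf 1 0 0; rewrite !scale1r !addr0 -{1}[f 0]addr0 => /addrI <-. Qed.

Lemma linD x y : f (x + y) = f x + f y.
Proof. by have := hf 1 x y; rewrite !scale1r. Qed.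

Lemma linZ k x : f (k *: x) = k *: f x.
Proof. by have := hf k x 0; rewrite lin0 !addr0. Qed.

Lemma linN x : f (- x) = - f x.
Proof. by rewrite -scaleN1r linZ scaleN1r. Qed.

Lemma linB x y : f (x - y) = f x - f y.
Proof. by rewrite linD linN. Qed.

Lemma lin_sum (I : Type) (r : seq I) (P : pred I) (F : I -> V) :
  f (\sum_(i <- r | P i) F i) = \sum_(i <- r | P i) f (F i).
Proof.
by elim/big_rec2: _ => [|i x y _ ih]; [exact: lin0|rewrite linD ih].
Qed.

End LinearMaps.

Section TensorLift.
Context (K : comNzRingType) (U V : lmodType K).

Lemma eq_tlift (W : lmodType K) (f g : U -> V -> W) t :
  f =2 g -> tlift f t = tlift g t.
Proof. by move=> h; apply: eq_bigr => p _; exact: h. Qed.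

Lemma tlift_comp (W W' : lmodType K) (L : W -> W') (f : U -> V -> W) t :
  linear L -> L (tlift f t) = tlift (fun a b => L (f a b)) t.
Proof. by move=> hL; rewrite /tlift /tsum lin_sum. Qed.

Lemma tliftD (W : lmodType K) (f g : U -> V -> W) t :
  tlift (fun a b => f a b + g a b) t = tlift f t + tlift g t.
Proof. by rewrite /tlift /tsum big_split. Qed.

Lemma tliftZ (W : lmodType K) k (f : U -> V -> W) t :
  tlift (fun a b => k *: f a b) t = k *: tlift f t.
Proof. by rewrite /tlift /tsum scaler_sumr. Qed.

End TensorLift.

HB.instance Definition _ (K : numFieldType) (H : lmodType K) (B : topAlgType K)
  (f : homSpace H B) := GRing.isLinear.Build K H B *:%R (hom_fun f) (hom_linear f).

(** * The convolution algebra Hom(H, B) *)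

Section HomEval.
Context (K : numFieldType) (H : lmodType K) (B : topAlgType K).
Local Notation A := (homSpace H B).

Lemma homDE (f g : A) x : (f + g : A) x = f x + g x. Proof. by []. Qed.
Lemma homZE k (f : A) x : (k *: f : A) x = k *: f x. Proof. by []. Qed.
Lemma hom0E x : (0 : A) x = 0. Proof. by []. Qed.
Lemma homNE (f : A) x : (- f : A) x = - f x.
Proof. by rewrite -scaleN1r homZE scaleN1r. Qed.
Lemma homBE (f g : A) x : (f - g : A) x = f x - g x.
Proof. by rewrite homDE homNE. Qed.
Lemma homSE (I : Type) (r : seq I) (P : pred I) (F : I -> A) x :
  (\sum_(i <- r | P i) F i : A) x = \sum_(i <- r | P i) F i x.
Proof. by elim/big_rec2: _ => // i y z _ <-. Qed.

End HomEval.

Section ConvolutionRing.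
Context (K : numFieldType) (H : hopfAlgType K) (B : comCiaType K).
Local Notation A := (homSpace H B).
Implicit Types f g h : A.

(** Both bracketings are values, at the two sides of coassociativity, of the linear
    map T3 on the threefold tensor product that sends a, b, c to f a * g b * h c. *)
Lemma convA : associative (@Defs.conv K H B).
Proof.
move=> f g h; apply: homP => x; rewrite !convE.
pose T3 := tlift (fun (a : H) (y : H ⊗ H) => f a * (tlift (fun c d => g c * h d) y : B)).
have gh := conv_bilinear g h.
have bT3 : bilinear_map
    (fun (a : H) (y : H ⊗ H) => f a * (tlift (fun c d => g c * h d) y : B)).
  split=> [y|a] k u v; first by rewrite linearP mulrDl topalg_scalerAl.
  by rewrite tlift_linear // mulrDr topalg_scalerAr.
have lT3 : linear T3 by exact: tlift_linear.
have bw (w : H) : bilinear_map (fun u v : H => u ⊗t (v ⊗t w)).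
  have [h1 h2] := @tens_bilinear K H H.
  have [h1' h2'] := @tens_bilinear K H (H ⊗ H).
  by split=> [v|u] k y z; rewrite ?h1' ?h1 ?h2'.
have bA : bilinear_map
    (fun (y : H ⊗ H) (w : H) => tlift (fun u v => u ⊗t (v ⊗t w)) y).
  split=> [w|y]; first exact: tlift_linear.
  move=> k v w; rewrite -tliftZ -tliftD; apply: eq_tlift => a b.
  have [_ h2] := @tens_bilinear K H H.
  by have [_ h2'] := @tens_bilinear K H (H ⊗ H); rewrite h2 h2'.
transitivity (T3 (tmap idfun (comul H) (comul H x))).
  rewrite /tmap tlift_comp //; apply: eq_tlift => a b.
  by rewrite /T3 tlift_tens.
rewrite -comulA /tmap tlift_comp //; last exact: tlift_linear.
rewrite tlift_comp //; apply: eq_tlift => a b.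
rewrite /tassoc tlift_tens // tlift_comp //.
rewrite convE (@tlift_comp _ _ _ _ _ (fun z : B => z * h b)); last first.
  by move=> k y z; rewrite mulrDl topalg_scalerAl.
by apply: eq_tlift => u v /=; rewrite /T3 tlift_tens // tlift_tens // mulrA.
Qed.

Lemma conv1l : left_id (@conv_one K H B) (@Defs.conv K H B).
Proof.
move=> f; apply: homP => x; rewrite -[in RHS](counitl x) convE.
rewrite tlift_comp; last exact: hom_linear.
by apply: eq_tlift => a b; rewrite conv_oneE -topalg_scalerAl mul1r linearZ.
Qed.

Lemma conv1r : right_id (@conv_one K H B) (@Defs.conv K H B).
Proof.
move=> f; apply: homP => x; rewrite -[in RHS](counitr x) convE.
rewrite tlift_comp; last exact: hom_linear.
by apply: eq_tlift => a b; rewrite conv_oneE -topalg_scalerAr mulr1 linearZ.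
Qed.

Lemma convDl : left_distributive (@Defs.conv K H B) +%R.
Proof.
move=> f g h; apply: homP => x.
change (Defs.conv (f + g) h x = Defs.conv f h x + Defs.conv g h x :> B).
by rewrite !convE -tliftD; apply: eq_tlift => a b; rewrite -mulrDl.
Qed.

Lemma convDr : right_distributive (@Defs.conv K H B) +%R.
Proof.
move=> f g h; apply: homP => x.
change (Defs.conv f (g + h) x = Defs.conv f g x + Defs.conv f h x :> B).
by rewrite !convE -tliftD; apply: eq_tlift => a b; rewrite -mulrDr.
Qed.

HB.instance Definition _ := GRing.Zmodule_isPzRing.Build (homSpace H B)
  convA conv1l conv1r convDl convDr.

Lemma homME (f g : A) x : (f * g : A) x = tlift (fun a b => f a * g b) (comul H x).
Proof. by []. Qed.
Lemma hom1E x : (1 : A) x = counit H x *: (1 : B). Proof. by []. Qed.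

Lemma homZAl k f g : k *: (f * g) = (k *: f) * g.
Proof.
apply: homP => x; rewrite homZE !homME -tliftZ; apply: eq_tlift => a b.
by rewrite homZE topalg_scalerAl.
Qed.

Lemma homZAr k f g : k *: (f * g) = f * (k *: g).
Proof.
apply: homP => x; rewrite homZE !homME -tliftZ; apply: eq_tlift => a b.
by rewrite homZE topalg_scalerAr.
Qed.

Lemma homXZ k f n : (k *: f) ^+ n = k ^+ n *: f ^+ n.
Proof.
elim: n => [|n ih]; first by rewrite !expr0 scale1r.
by rewrite !exprS ih -homZAl -homZAr scalerA.
Qed.

Lemma conv_mulE f g a b :
  (f * g : A) (a * b) = tlift (fun a1 a2 =>
    tlift (fun b1 b2 => f (a1 * b1) * g (a2 * b2)) (comul H b)) (comul H a).
Proof.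
rewrite homME comulM /tmul tlift_comp; last exact/tlift_linear/conv_bilinear.
apply: eq_tlift => a1 a2; rewrite tlift_comp; last exact/tlift_linear/conv_bilinear.
by apply: eq_tlift => b1 b2; rewrite tlift_tens //; exact: conv_bilinear.
Qed.

Lemma tlift_mul (f1 f2 g1 g2 : A) a b :
  tlift (fun a1 a2 => tlift (fun b1 b2 => (f1 a1 * g1 b1) * (f2 a2 * g2 b2))
    (comul H b)) (comul H a) = (f1 * f2 : A) a * (g1 * g2 : A) b.
Proof.
rewrite !homME (@tlift_comp _ _ _ _ _ (fun z : B => z * _)); last first.
  by move=> k y z; rewrite mulrDl topalg_scalerAl.
apply: eq_tlift => a1 a2; rewrite tlift_comp; last first.
  by move=> k y z; rewrite mulrDr topalg_scalerAr.
by apply: eq_tlift => b1 b2; rewrite mulrACA.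
Qed.

Lemma inf_charE (x : A) a b : inf_characters x ->
  x (a * b) = x a * (1 : A) b + (1 : A) a * x b.
Proof.
by move=> ->; rewrite !hom1E -topalg_scalerAr mulr1 -topalg_scalerAl mul1r.
Qed.

(** An infinitesimal character acts as a derivation, so its convolution powers obey
    the Leibniz formula. *)
Lemma inf_charX (x : A) n a b : inf_characters x ->
  (x ^+ n : A) (a * b) = \sum_(i < n.+1) ((x ^+ i : A) a * (x ^+ (n - i) : A) b) *+ 'C(n, i).
Proof.
move=> hx; elim: n a b => [|n ih] a b.
  rewrite big_ord1 mulr1n !hom1E counitM.
  by rewrite -topalg_scalerAl mul1r scalerA.
rewrite exprS conv_mulE.
transitivity (\sum_(i < n.+1) (((x ^+ i.+1 : A) a * (x ^+ (n - i) : A) b) *+ 'C(n, i) +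
     ((x ^+ i : A) a * (x ^+ (n - i).+1 : A) b) *+ 'C(n, i))).
  under eq_tlift => a1 a2.
    under eq_tlift => b1 b2.
      rewrite inf_charE // ih mulr_sumr.
      over.
    over.
  rewrite /tlift /tsum.
  under eq_bigr do rewrite exchange_big /=.
  rewrite exchange_big /=; apply: eq_bigr => i _.
  rewrite -!mulrnDl exprS exprS.
  have -> : ((x * x ^+ i : A) a * (x ^+ (n - i) : A) b) =
            ((x * x ^+ i : A) a * (1 * x ^+ (n - i) : A) b) by rewrite mul1r.
  have -> : ((x ^+ i : A) a * (x * x ^+ (n - i) : A) b) =
            ((1 * x ^+ i : A) a * (x * x ^+ (n - i) : A) b) by rewrite mul1r.
  rewrite -!tlift_mul -tliftD /tlift /tsum -sumrMnl; apply: eq_bigr => p _.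
  rewrite -big_split /= -sumrMnl; apply: eq_bigr => q _.
  by rewrite -mulrDl mulrnAr.
rewrite big_split /= [RHS]big_ord_recl bin0 subn0.
under [X in _ = _ + X]eq_bigr => i _ do rewrite lift0 binS subSS mulrnDr.
rewrite big_split /= addrA addrC; congr (_ + _).
rewrite [LHS]big_ord_recl [X in _ = _ + X]big_ord_recr /= (@bin_small n n.+1) //.
rewrite mulr0n addr0.
rewrite bin0 subn0; congr (_ + _); apply: eq_bigr => i _.
by rewrite /bump /= add1n subnSK.
Qed.

Lemma inf_char1 (x : A) : inf_characters x -> x 1 = 0.
Proof.
move=> hi; have := hi 1 1; rewrite mulr1 counit1 !scale1r => e.
by rewrite -[LHS](addrK (x 1)) -e subrr.
Qed.

End ConvolutionRing.

(** * Rearranging finite sums *)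

Section BigSums.

Lemma sub_sub_telescope (V : zmodType) (a a' b b' d : V) :
  a - b - d = (a - a') - (b - b') + (a' - b' - d).
Proof.
rewrite opprB -[a - b - d]addrA -[RHS]addrA.
have -> : (b' - b) + (a' - b' - d) = a' + (- b - d).
  by rewrite addrC -!addrA; congr (_ + _); rewrite [- d + _]addrCA addKr addrC.
by rewrite subrKA addrA.
Qed.

Lemma sum_antidiag (V : nmodType) (N : nat) (c : nat -> nat -> V) :
  (forall i j, (N <= i + j)%N -> c i j = 0) ->
  \sum_(i < N) \sum_(j < N) c i j = \sum_(n < N) \sum_(i < n.+1) c i (n - i)%N.
Proof.
move=> hc; symmetry.
transitivity (\sum_(n < N) \sum_(i < N | (i < n.+1)%N) c i (n - i)%N).
  by apply: eq_bigr => n _; rewrite (big_ord_widen N (fun i => c i (n - i)%N)).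
rewrite (exchange_big_dep xpredT) //=; apply: eq_bigr => i _.
rewrite -(big_mkord xpredT (c i)) (big_cat_nat (n := (N - i)%N)) ?leq_subr //=.
rewrite [X in _ = _ + X]big_nat_cond [X in _ = _ + X]big1 ?addr0; last first.
  by move=> j /andP[/andP[h _] _]; apply: hc; rewrite -leq_subLR.
transitivity (\sum_(0 + i <= n < N) c i (n - i)%N).
  rewrite add0n [RHS](big_nat_widenl _ 0%N) // big_mkord.
  by apply: eq_bigl => n; rewrite ltnS.
by rewrite (big_addn 0 N i); apply: eq_bigr => j _; rewrite addnK.
Qed.

(** The Vandermonde matrix of the powers of 2 is invertible; the induction removes
    the last coefficient by replacing P(2t) - 2^N P(t) for P(t).  Only powers of 2
    are needed because doubling is the only functional equation of exp used. *)
Lemma vandermonde_pow2 (K : numFieldType) (V : lmodType K) (N : nat) (v : nat -> V) :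
  (forall i : nat, \sum_(k < N) ((2 ^+ i) ^+ k : K) *: v k = 0) ->
  forall k, (k < N)%N -> v k = 0.
Proof.
elim: N v => [//|N ih] v hv.
have h k : (k < N)%N -> v k = 0.
  move=> kN; have := ih (fun k => (2 ^+ k - 2 ^+ N : K) *: v k) _ k kN.
  move=> h.
  have : ((2 ^+ k - 2 ^+ N : K) == 0) \/ (v k == 0).
    apply/orP; rewrite -scaler_eq0; apply/eqP/h => i.
    have e1 := hv i.+1; have e2 := hv i.
    transitivity (\sum_(k < N.+1) (2 ^+ i.+1) ^+ k *: v k -
      (2 ^+ N : K) *: (\sum_(k < N.+1) ((2 ^+ i) ^+ k : K) *: v k)); last first.
      by rewrite e1 e2 scaler0 subr0.
    rewrite scaler_sumr -sumrB big_ord_recr /= scalerA -scalerBl.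
    rewrite exprS exprMn subrr scale0r addr0; apply: eq_bigr => j _.
    by rewrite !scalerA -scalerBl exprMn mulrBr mulrC [X in _ - X]mulrC.
  move=> [|/eqP//]; rewrite subr_eq0 => /eqP e.
  have : (2 ^+ k < 2 ^+ N :> K) by rewrite ltr_eXn2l // ltr1n.
  by rewrite e ltxx.
move=> k; rewrite ltnS leq_eqVlt => /orP[/eqP ->|]; last exact: h.
have := hv 0%N; rewrite big_ord_recr /= big1 ?add0r ?expr0 ?expr1n ?scale1r //.
by move=> i _; rewrite h // scaler0.
Qed.

End BigSums.

(** * The degree filtration; exponential and logarithm *)

Section Filtration.
Context (K : numFieldType) (H : hopfAlgType K) (Hn : nat -> set H).
Context (hg : hopf_grading Hn) (B : comCiaType K).
Local Notation A := (homSpace H B).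
Implicit Types (x y d phi : A).

Definition deg_lt n : set H :=
  [set a | exists2 y : nat -> H, (forall m, Hn m (y m)) & a = \sum_(m < n) y m].

Lemma hom_comp_sub n : subspace_set (Hn n).
Proof. by case: hg => -[]. Qed.

Lemma hom_comp0 n : Hn n 0. Proof. by have [] := hom_comp_sub n. Qed.

Lemma hom_compZD n k u v : Hn n u -> Hn n v -> Hn n (k *: u + v).
Proof. by have [_] := hom_comp_sub n; apply. Qed.

Lemma deg_lt_hom n m a : Hn m a -> (m < n)%N -> deg_lt n a.
Proof.
move=> ha mn; exists (fun i => if i == m then a else 0).
  by move=> i; case: eqP => [->//|_]; exact: hom_comp0.
rewrite (bigD1 (Ordinal mn)) //= eqxx big1 ?addr0 // => i.
by rewrite -val_eqE /= => /negbTE ->.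
Qed.

Lemma deg_lt_lin n k u v : deg_lt n u -> deg_lt n v -> deg_lt n (k *: u + v).
Proof.
move=> [y hy ->] [z hz ->]; exists (fun m => k *: y m + z m).
  by move=> m; exact: hom_compZD.
by rewrite scaler_sumr big_split.
Qed.

Lemma deg_lt0 n : deg_lt n 0.
Proof. by exists (fun=> 0) => [m|]; [exact: hom_comp0|rewrite big1]. Qed.

Lemma deg_lt_sum n (I : Type) (r : seq I) (F : I -> H) :
  (forall i, deg_lt n (F i)) -> deg_lt n (\sum_(i <- r) F i).
Proof.
move=> h; elim/big_rec: _ => [|i x _ hx]; first exact: deg_lt0.
by rewrite -[F i]scale1r; exact: deg_lt_lin.
Qed.

Lemma deg_lt_le n m a : (n <= m)%N -> deg_lt n a -> deg_lt m a.
Proof.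
move=> nm [y hy ->]; apply: deg_lt_sum => i; apply: (deg_lt_hom (hy i)).
exact: leq_trans nm.
Qed.

Lemma deg_ltM n m a b : deg_lt n a -> deg_lt m b -> deg_lt (n + m) (a * b).
Proof.
move=> [y hy ->] [z hz ->]; rewrite mulr_suml; apply: deg_lt_sum => i.
rewrite mulr_sumr; apply: deg_lt_sum => j.
case: hg => _ hM _; apply: (deg_lt_hom (hM _ _ _ _ (hy i) (hz j))).
by rewrite -addnS leq_add // ltnW.
Qed.

Lemma deg_lt_ex a : exists n, deg_lt n a.
Proof. by case: hg => -[_ h _] _ _; have [n [y [hy ->]]] := h a; exists n, y. Qed.

Definition degree_bound a : nat := sval (cid (deg_lt_ex a)).

Lemma degree_boundP a : deg_lt (degree_bound a) a.
Proof. by rewrite /degree_bound; case: cid. Qed.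

(** The ideal F_n of the linear maps that vanish in degrees below n. *)
Definition filt n : set A := [set x | forall m a, (m < n)%N -> Hn m a -> x a = 0].

Lemma filt_eval n x a : filt n x -> deg_lt n a -> x a = 0.
Proof. by move=> hx [y hy ->]; rewrite raddf_sum big1 // => i _; exact: hx (hy _). Qed.

Lemma filt0 n : filt n 0. Proof. by move=> m a _ _. Qed.

Lemma filt_all x : filt 0 x. Proof. by move=> m a. Qed.

Lemma filtD n x y : filt n x -> filt n y -> filt n (x + y).
Proof. by move=> hx hy m a mn ha; rewrite homDE (hx m) ?(hy m) ?addr0. Qed.

Lemma filtZ n k x : filt n x -> filt n (k *: x).
Proof. by move=> hx m a mn ha; rewrite homZE (hx m) ?scaler0. Qed.

Lemma filtN n x : filt n x -> filt n (- x).
Proof. by rewrite -scaleN1r; exact: filtZ. Qed.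

Lemma filtB n x y : filt n x -> filt n y -> filt n (x - y).
Proof. by move=> hx hy; apply/filtD/filtN. Qed.

Lemma filt_sum n (I : Type) (r : seq I) (P : pred I) (F : I -> A) :
  (forall i, P i -> filt n (F i)) -> filt n (\sum_(i <- r | P i) F i).
Proof.
by move=> h; elim/big_rec: _ => [|i x Pi hx]; [exact: filt0|apply: filtD => //; exact: h].
Qed.

Lemma filt_le n m x : (m <= n)%N -> filt n x -> filt m x.
Proof. by move=> mn hx k a km; apply: hx; exact: leq_trans mn. Qed.

Lemma filt_sep x : (forall n, filt n x) -> x = 0.
Proof.
move=> hx; apply: homP => a; apply: (filt_eval (hx _)); exact: degree_boundP.
Qed.

(** A summand of the coproduct in bidegree (k, l) with k + l < m + n has k < m or
    l < n. *)
Lemma filtM m n x y : filt m x -> filt n y -> filt (m + n) (x * y).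
Proof.
move=> hx hy d a dmn ha; case: hg => _ _ /(_ d a ha)[s [hs e]].
rewrite homME e tlift_sum; last exact: conv_bilinear.
rewrite big_seq big1 // => p /hs[k [l [kl hk hl]]].
rewrite tlift_tens; last exact: conv_bilinear.
have [km|mk] := ltnP k m; first by rewrite (hx k) // mul0r.
rewrite (hy l) ?mulr0 //; rewrite -kl in dmn.
by rewrite -(ltn_add2l m); apply: leq_ltn_trans dmn; rewrite leq_add2r.
Qed.

Lemma filtX n x : filt 1 x -> filt n (x ^+ n).
Proof.
move=> hx; elim: n => [|n ih]; first exact: filt_all.
by rewrite exprS -add1n; exact: filtM.
Qed.

Lemma filtMl n x y : filt n y -> filt n (x * y).
Proof. by rewrite -{2}[n]add0n; apply: filtM; exact: filt_all. Qed.

Lemma filtMr n x y : filt n x -> filt n (x * y).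
Proof. by move=> h; rewrite -[n]addn0; apply: filtM => //; exact: filt_all. Qed.

Lemma filt_trans n x y z : filt n (x - y) -> filt n (y - z) -> filt n (x - z).
Proof. by move=> h1 h2; rewrite -(subrKA y); exact: filtD. Qed.

Definition filt_lim (X : nat -> A) : A := xget 0 [set y | forall n, filt n (y - X n)].

(** Completeness: the sequence is eventually constant at each element of H, so the
    pointwise limit exists without any topology on B. *)
Lemma filt_limP (X : nat -> A) :
  (forall n, filt n (X n.+1 - X n)) -> forall n, filt n (filt_lim X - X n).
Proof.
move=> hX.
have hle n m : (n <= m)%N -> filt n (X m - X n).
  elim: m => [|m ih]; first by rewrite leqn0 => /eqP ->; rewrite subrr; exact: filt0.
  rewrite leq_eqVlt => /orP[/eqP ->|]; first by rewrite subrr; exact: filt0.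
  rewrite ltnS => nm; apply: filt_trans (ih nm); exact: filt_le (hX m).
have he n m a : deg_lt n a -> (n <= m)%N -> X m a = X n a.
  move=> ha nm; apply/eqP; rewrite -subr_eq0 -homBE; apply/eqP.
  exact: filt_eval (hle _ _ nm) ha.
have ye n a : deg_lt n a -> X (degree_bound a) a = X n a.
  move=> ha; have [nm|/ltnW mn] := leqP n (degree_bound a); first exact: he.
  by apply/esym/he => //; exact: degree_boundP.
have yl : linear (fun a => X (degree_bound a) a).
  move=> k u v; pose N := maxn (degree_bound u) (degree_bound v).
  have hu : deg_lt N u by apply: deg_lt_le (degree_boundP u); exact: leq_maxl.
  have hv : deg_lt N v by apply: deg_lt_le (degree_boundP v); exact: leq_maxr.
  by rewrite (ye N _ hu) (ye N _ hv) (ye N) ?linearP //; exact: deg_lt_lin.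
have : [set y | forall n, filt n (y - X n)] (mkHom yl).
  move=> n m a mn ha; rewrite homBE.
  by rewrite [mkHom yl a](ye n) ?subrr //; exact: deg_lt_hom ha mn.
move=> hy; exact: (@xgetPex _ 0 _ (ex_intro _ _ hy)).
Qed.

Definition expt n x : A := \sum_(k < n) (k`!%:R)^-1 *: x ^+ k.
Definition expo x := filt_lim (fun n => expt n x).

Lemma expoP x n : filt 1 x -> filt n (expo x - expt n x).
Proof.
move=> hx; apply: (@filt_limP (fun n => expt n x)) => m.
rewrite /expt big_ord_recr /= addrAC subrr add0r; apply: filtZ; exact: filtX.
Qed.

Lemma expo_eval x n a : filt 1 x -> deg_lt n a ->
  expo x a = \sum_(k < n) (k`!%:R)^-1 *: (x ^+ k : A) a.
Proof.
move=> hx ha; have /eqP := filt_eval (expoP (n := n) hx) ha.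
by rewrite homBE homSE subr_eq0 => /eqP.
Qed.

(** Expanding the power of a sum, each term other than the power of x contains a
    factor d of order n + 1 and k factors of order 1. *)
Lemma powdiff x d n k : filt 1 x -> filt n.+1 d ->
  filt (n.+1 + k) ((x + d) ^+ k.+1 - x ^+ k.+1).
Proof.
move=> hx hd; elim: k => [|k ih]; first by rewrite !expr1 addrC addKr addn0.
have -> : (x + d) ^+ k.+2 - x ^+ k.+2 =
    (x + d) * ((x + d) ^+ k.+1 - x ^+ k.+1) + d * x ^+ k.+1.
  by rewrite mulrBr -!exprS mulrDl -exprS opprD addrA subrK.
apply: filtD; last by apply: filtM => //; exact: filtX.
rewrite addnS -add1n; apply: filtM => //; apply: filtD => //.
exact: filt_le hd.
Qed.

(** To first order, adding d to the argument adds d to the exponential.  This is the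
    Newton step behind both the injectivity and the surjectivity of exp. *)
Lemma expoD x d n : filt 1 x -> filt n.+1 d ->
  filt n.+2 (expo (x + d) - expo x - d).
Proof.
move=> hx hd.
have hxd : filt 1 (x + d) by apply: filtD => //; exact: filt_le hd.
have h1 := expoP (n := n.+2) hxd.
have h2 := expoP (n := n.+2) hx.
have h : filt n.+2 (expt n.+2 (x + d) - expt n.+2 x - d).
  rewrite /expt -sumrB 2!big_ord_recl /= !expr0 subrr add0r.
  rewrite (_ : (bump 0 0)`! = 1%N) // (_ : bump 0 0 = 1%N) // !expr1 invr1 !scale1r.
  rewrite addrAC (addrC x) addrK subrr add0r.
  apply: filt_sum => i _; rewrite -scalerBr; apply: filtZ.
  rewrite (addrC d) /bump !add1n; apply: filt_le (powdiff (k := i.+1) hx hd).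
  by rewrite addSn addnS !ltnS leq_addr.
have -> : expo (x + d) - expo x - d = (expo (x + d) - expt n.+2 (x + d)) -
   (expo x - expt n.+2 x) + (expt n.+2 (x + d) - expt n.+2 x - d).
  exact: sub_sub_telescope.
by apply: filtD => //; exact: filtB.
Qed.


Lemma expo0 : expo 0 = 1.
Proof.
apply/eqP; rewrite -subr_eq0; apply/eqP/filt_sep => -[|n]; first exact: filt_all.
have := expoP (n := n.+1) (@filt0 1); rewrite /expt big_ord_recl /= factE invr1.
rewrite expr0 scale1r big1 ?addr0 // => i _.
by rewrite /bump /= add1n exprS mul0r scaler0.
Qed.

Lemma expo_filt1 x : filt 1 x -> filt 1 (expo x - 1).
Proof.
move=> hx; have := expoP (n := 1) hx.
by rewrite /expt big_ord1 factE invr1 expr0 scale1r.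
Qed.

Lemma expo_cong n x y : filt 1 x -> filt 1 y -> filt n (x - y) ->
  filt n (expo x - expo y).
Proof.
case: n => [*|n hx hy hxy]; first exact: filt_all.
have := expoD hy hxy; rewrite subrKC => h.
rewrite -[expo x - expo y](subrK (x - y)); apply: filtD => //; exact: filt_le h.
Qed.

Lemma expo_inj x y : filt 1 x -> filt 1 y -> expo x = expo y -> x = y.
Proof.
move=> hx hy e; apply/eqP; rewrite -subr_eq0; apply/eqP/filt_sep.
elim=> [|n ih]; first exact: filt_all.
case: n ih => [|n] ih; first exact: filtB.
have := expoD hy ih; rewrite subrKC e subrr sub0r => /filtN.
by rewrite opprK.
Qed.

(** Successive approximations of the logarithm.  This iteration replaces the usual
    series: it yields surjectivity of exp without any identity between power
    series, and its terms are visibly polynomial in phi. *)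
Fixpoint logt n phi : A :=
  if n is m.+1 then logt m phi + (phi - expo (logt m phi)) else 0.
Definition logo phi := filt_lim (logt^~ phi).

Lemma logtP n phi : filt 1 (phi - 1) ->
  filt 1 (logt n phi) /\ filt n.+1 (phi - expo (logt n phi)).
Proof.
move=> hphi; elim: n => [|n [h1 h2]] /=; first by rewrite expo0; split=> //; exact: filt0.
split; first by apply: filtD => //; exact: filt_le h2.
have := filtN (expoD h1 h2); rewrite opprB opprB addrA.
by rewrite subrK.
Qed.

Lemma logoP n phi : filt 1 (phi - 1) -> filt n (logo phi - logt n phi).
Proof.
move=> hphi; apply: (@filt_limP (logt^~ phi)) => m /=.
by rewrite addrAC subrr add0r; apply: filt_le (logtP m hphi).2.
Qed.

Lemma logo_eval n a phi : filt 1 (phi - 1) -> deg_lt n a -> logo phi a = logt n phi a.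
Proof.
move=> hp ha; apply/eqP; rewrite -subr_eq0 -homBE; apply/eqP.
exact: filt_eval (logoP (n := n) hp) ha.
Qed.

Lemma logo_filt1 phi : filt 1 (phi - 1) -> filt 1 (logo phi).
Proof.
move=> hp; rewrite -(subrK (logt 1 phi) (logo phi)); apply: filtD.
  exact: logoP.
by have [] := logtP 1 hp.
Qed.

Lemma logoK phi : filt 1 (phi - 1) -> expo (logo phi) = phi.
Proof.
move=> hp; apply/eqP; rewrite -subr_eq0; apply/eqP/filt_sep => n.
have [h1 h2] := logtP n hp.
apply: (filt_trans (y := expo (logt n phi))).
  by apply: expo_cong => //; [exact: logo_filt1|exact: logoP].
by rewrite -opprB; apply/filtN/filt_le/h2.
Qed.

(** Evaluated at a fixed element, the product of the two series is a finite double
    sum; collecting terms of equal total order gives the binomial sums 2^n. *)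
Lemma expo_double x : filt 1 x -> expo (2 *: x) = expo x * expo x.
Proof.
move=> hx; apply/homP => a; have [N ha] := deg_lt_ex a.
rewrite (expo_eval (filtZ 2 hx) ha).
have -> : (expo x * expo x : A) a = (expt N x * expt N x : A) a.
  apply/eqP; rewrite -subr_eq0 -homBE; apply/eqP/(filt_eval _ ha).
  apply: (filt_trans (y := expo x * expt N x)).
    by rewrite -mulrBr; apply/filtMl/expoP.
  by rewrite -mulrBl; apply/filtMr/expoP.
rewrite /expt mulr_suml homSE.
pose c i j : B := ((i`!%:R)^-1 * (j`!%:R)^-1 : K) *: (x ^+ (i + j) : A) a.
transitivity (\sum_(i < N) \sum_(j < N) c i j); last first.
  apply: eq_bigr => i _; rewrite mulr_sumr homSE; apply: eq_bigr => j _.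
  by rewrite -homZAl -homZAr -exprD !homZE scalerA.
rewrite sum_antidiag => [|i j ij]; last first.
  rewrite /c (filt_eval (n := N)) ?scaler0 //; exact: (filt_le ij (filtX hx)).
apply: eq_bigr => n _.
transitivity (\sum_(i < n.+1) ('C(n, i)%:R * (n`!%:R)^-1 : K) *: (x ^+ n : A) a).
  rewrite -scaler_suml -mulr_suml -natr_sum.
  have -> : (\sum_(i < n.+1) 'C(n, i) = 2 ^ n)%N.
    by rewrite -[2%N]/(1 + 1)%N expnDn; apply: eq_bigr => i _; rewrite !exp1n !muln1.
  by rewrite homXZ homZE scalerA natrX mulrC.
apply: eq_bigr => i _; have iN : (i <= n)%N by rewrite -ltnS.
rewrite /c subnKC // -(bin_fact iN) !natrM; congr (_ *: _).
by rewrite invfM mulrA mulfV ?mul1r ?invfM // pnatr_eq0 -lt0n bin_gt0.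
Qed.

(** The double sum can be truncated along antidiagonals because x^i(a) x^j(b)
    vanishes once i + j reaches the sum of the degree bounds of a and b. *)
Lemma sum_exp_mul x N a b : filt 1 x -> deg_lt N (a * b) -> forall na nb,
   deg_lt na a -> deg_lt nb b -> (na + nb <= N)%N ->
   expo x a * expo x b = \sum_(n < N) \sum_(i < n.+1)
     ((i`!%:R)^-1 * ((n - i)`!%:R)^-1 : K) *: ((x ^+ i : A) a * (x ^+ (n - i) : A) b).
Proof.
move=> hx hab na nb ha hb le.
have haN : deg_lt N a by apply: deg_lt_le ha; apply: leq_trans le; exact: leq_addr.
have hbN : deg_lt N b by apply: deg_lt_le hb; apply: leq_trans le; exact: leq_addl.
rewrite (expo_eval hx haN) (expo_eval hx hbN) mulr_suml.
rewrite -(sum_antidiag (c := fun i j =>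
  ((i`!%:R)^-1 * (j`!%:R)^-1 : K) *: ((x ^+ i : A) a * (x ^+ j : A) b))).
  apply: eq_bigr => i _; rewrite mulr_sumr; apply: eq_bigr => j _.
  by rewrite -topalg_scalerAl -topalg_scalerAr scalerA.
move=> i j Nij; have [nai|ian] := leqP na i.
  rewrite (filt_eval (n := na) (x := x ^+ i)) ?mul0r ?scaler0 //.
  exact: (filt_le nai (filtX hx)).
rewrite (filt_eval (n := nb) (x := x ^+ j)) ?mulr0 ?scaler0 //.
apply: (filt_le _ (filtX hx)); rewrite -(leq_add2l na).
by apply: (leq_trans le); apply: (leq_trans Nij); rewrite leq_add2r ltnW.
Qed.

Lemma expo_char x : filt 1 x -> inf_characters x -> characters (expo x).
Proof.
move=> hx hi; split=> [a b|].
  have [na ha] := deg_lt_ex a; have [nb hb] := deg_lt_ex b.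
  have hab := deg_ltM ha hb.
  rewrite (sum_exp_mul hx hab ha hb) // (expo_eval hx hab).
  apply: eq_bigr => n _; rewrite inf_charX // scaler_sumr.
  apply: eq_bigr => i _; have iN : (i <= n)%N by rewrite -ltnS.
  rewrite -scaler_nat scalerA -(bin_fact iN) !natrM; congr (_ *: _).
  by rewrite invfM mulrAC mulVf ?mul1r ?invfM // pnatr_eq0 -lt0n bin_gt0.
have x1 : x 1 = 0 by exact: inf_char1.
have [n h1] := deg_lt_ex (1 : H).
rewrite (expo_eval hx (deg_lt_le (leqnSn n) h1)) big_ord_recl /= big1 ?addr0.
  by rewrite factE invr1 scale1r expr0 hom1E counit1 scale1r.
move=> i _; rewrite /bump /= add1n exprS homME comul1 tlift_tens ?x1 ?mul0r ?scaler0 //.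
exact: conv_bilinear.
Qed.

(** All exp (2^i x) are characters, being iterated squares of exp x.  The defect of
    multiplicativity at (a, b) is a polynomial in 2^i whose linear coefficient is
    the defect of x from being an infinitesimal character. *)
Lemma char_expo_inf x : filt 1 x -> characters (expo x) -> inf_characters x.
Proof.
move=> hx hc a b.
have hci i : characters (expo ((2 ^+ i : K) *: x)).
  elim: i => [|i ih]; first by rewrite expr0 scale1r.
  rewrite exprS -scalerA expo_double; last exact: filtZ.
  exact: conv_characters.
have [na ha] := deg_lt_ex a; have [nb hb] := deg_lt_ex b.
pose N := (na + nb).+2.
have hab : deg_lt N (a * b).
  by apply: deg_lt_le (deg_ltM ha hb); rewrite /N; do 2 apply: leqW.
pose v n : B := (n`!%:R : K)^-1 *: (x ^+ n : A) (a * b) - \sum_(i < n.+1)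
     ((i`!%:R)^-1 * ((n - i)`!%:R)^-1 : K) *: ((x ^+ i : A) a * (x ^+ (n - i) : A) b).
have hv : forall i : nat, \sum_(n < N) ((2 ^+ i) ^+ n : K) *: v n = 0.
  move=> i; have [+ _] := hci i => /(_ a b)/eqP.
  rewrite -subr_eq0 => /eqP e; rewrite -[RHS]e {e}; have hxi := filtZ (2 ^+ i) hx.
  rewrite (expo_eval hxi hab) (sum_exp_mul hxi hab ha hb); last by rewrite /N; do 2 apply: leqW.
  rewrite -sumrB; apply: eq_bigr => n _; rewrite /v scalerBr; congr (_ - _).
    by rewrite homXZ homZE !scalerA mulrC.
  rewrite scaler_sumr; apply: eq_bigr => j _.
  rewrite !homXZ !homZE -topalg_scalerAl -topalg_scalerAr !scalerA.
  by congr (_ *: _); rewrite -mulrA -exprD subnKC 1?mulrC // -ltnS.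
have /eqP := @vandermonde_pow2 _ _ N v hv 1%N isT.
rewrite /v subr_eq0 big_ord_recl big_ord1 /= !factE invr1 mulr1 !scale1r.
rewrite !expr1 !expr0 => /eqP ->; rewrite !hom1E.
by rewrite -topalg_scalerAl mul1r -topalg_scalerAr mulr1 addrC.
Qed.

End Filtration.

(** * Separating a vector from a subspace *)

Section Separation.
Context (K : fieldType) (V : lmodType K).

(** Zorn's lemma gives a subspace M that is maximal among those containing W and
    avoiding a; then V is the direct sum of M and the line through a. *)
Lemma functional_ex (W : set V) (a : V) : subspace_set W -> ~ W a ->
  exists f : V -> K, [/\ linear (f : V -> K^o), forall w, W w -> f w = 0 & f a = 1].
Proof.
move=> sW Wa.
pose good (M : set V) := [/\ subspace_set M, W `<=` M & ~ M a].
have [|M [gM maxM]] := @Zorn_bigcup V [set M | M = set0 \/ good M].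
  move=> F hF tot.
  have [[X [FX X0]]|none] := pselect (exists X, F X /\ X != set0); last first.
    left; rewrite -subset0 => x [X FX Xx]; case: none; exists X; split=> //.
    by apply/set0P; exists x.
  right; have gX Y y : F Y -> Y y -> good Y.
    by move=> FY Yy; case: (hF _ FY) => // Y0; rewrite Y0 in Yy.
  have /set0P[x Xx] := X0; have [[X00 _] WX _] := gX _ _ FX Xx; split.
  - split; first by exists X.
    move=> k u v [Y FY Yu] [Z FZ Zv].
    have [YZ|ZY] := tot _ _ FY FZ.
      exists Z => //; have [[_ h] _ _] := gX _ _ FZ Zv; exact: h (YZ _ Yu) Zv.
    exists Y => //; have [[_ h] _ _] := gX _ _ FY Yu; exact: h Yu (ZY _ Zv).
  - by move=> w Ww; exists X => //; exact: WX.
  - by move=> [Y FY Ya]; have [_ _] := gX _ _ FY Ya; apply.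
have {}gM : good M.
  case: gM => // M0; exfalso; apply: (maxM W); last by right; split.
  rewrite M0 properEneq; split; last exact: sub0set.
  by apply/eqP => /esym W0; case: sW; rewrite W0.
have [[M0 MZD] WM Ma] := gM.
have MZ k v : M v -> M (k *: v) by move=> Mv; rewrite -[_ *: _]addr0; exact: MZD.
have MD u v : M u -> M v -> M (u + v) by move=> Mu Mv; rewrite -[u]scale1r; exact: MZD.
have ex v : exists c, M (v - c *: a).
  have [Mv|Mv] := pselect (M v); first by exists 0; rewrite scale0r subr0.
  pose M' := [set x | exists m k, M m /\ x = m + k *: v].
  have M'sub : subspace_set M'.
    split; first by exists 0, 0; rewrite scale0r addr0.
    move=> k _ _ [m [l [Mm ->]]] [m' [l' [Mm' ->]]].
    exists (k *: m + m'), (k * l + l'); split; first exact: MZD.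
    by rewrite scalerDr scalerDl scalerA addrACA.
  have MM' : M `<=` M' by move=> m Mm; exists m, 0; rewrite scale0r addr0.
  have [[m [k [Mm e]]]|nM'a] := pselect (M' a).
    have k0 : k != 0.
      by apply/eqP => k0; apply: Ma; rewrite e k0 scale0r addr0.
    exists k^-1; have -> : v - k^-1 *: a = (- k^-1) *: m.
      by rewrite e scalerDr scalerA mulVf // scale1r opprD addrCA subrr addr0 scaleNr.
    exact: MZ.
  exfalso; apply: (maxM M'); last by right; split=> // w /WM/MM'.
  rewrite properEneq; split=> //; apply/eqP => e; apply: Mv; rewrite e.
  by exists 0, 1; split=> //; rewrite scale1r add0r.
have uniq v c c' : M (v - c *: a) -> M (v - c' *: a) -> c = c'.
  move=> h h'; have : M ((c' - c) *: a).
    have -> : (c' - c) *: a = (v - c *: a) + (-1) *: (v - c' *: a).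
      by rewrite scaleN1r opprB scalerBl [RHS]addrC subrKA.
    by apply: MD => //; exact: MZ.
  move=> hm; apply/eqP; rewrite eq_sym -subr_eq0; apply/negPn/negP => c0.
  by apply: Ma; rewrite -[a]scale1r -(mulVf c0) -scalerA; exact: MZ.
pose f v := sval (cid (ex v)); have fP v : M (v - f v *: a) by rewrite /f; case: cid.
exists f; split.
- move=> k u v; apply: (uniq (k *: u + v)) => //.
  have -> : k *: u + v - (k * f u + f v) *: a = k *: (u - f u *: a) + (v - f v *: a).
    by rewrite scalerBr scalerDl scalerA opprD addrACA.
  exact: MZD.
- by move=> w Ww; apply: (uniq w) => //; rewrite scale0r subr0; exact: WM.
- by apply: (uniq a) => //; rewrite scale1r subrr.
Qed.

End Separation.

(** * Homogeneous components of a graded Hopf algebra *)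

Section DegreeZero.
Context (K : numFieldType) (H : hopfAlgType K) (Hn : nat -> set H).
Context (hg : hopf_grading Hn).

Let hom0 n : Hn n 0 := hom_comp0 hg n.

(** Outside the ranges of summation the components count as zero, whence the
    conditionals. *)
Lemma decomposition_uniq (y z : nat -> H) N M :
  (forall n, Hn n (y n)) -> (forall n, Hn n (z n)) ->
  \sum_(n < N) y n = \sum_(n < M) z n ->
  forall n, (if (n < N)%N then y n else 0) = (if (n < M)%N then z n else 0).
Proof.
move=> hy hz e n; pose T := maxn (maxn N M) n.+1.
pose w n := (-1) *: (if (n < M)%N then z n else 0) + (if (n < N)%N then y n else 0).
have hw m : Hn m (w m) by apply: (hom_compZD hg); case: ifP.
case: hg => -[_ _ /(_ T w hw) h] _ _.
have := h _ n; rewrite /w scaleN1r => e'; apply/eqP.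
rewrite -subr_eq0 addrC; apply/eqP/e'; last by rewrite leq_max ltnSn orbT.
rewrite /w big_split /= -scaler_sumr -!big_mkcond /=.
rewrite -(big_ord_widen T y) -?(big_ord_widen T z) ?e ?scaleN1r ?addNr //.
  by rewrite /T !leq_max leqnn orbT.
by rewrite /T !leq_max leqnn.
Qed.

Definition hproj n (a : H) : H :=
  let N := sval (cid (deg_lt_ex hg a)) in
  let y := s2val (cid2 (svalP (cid (deg_lt_ex hg a)))) in
  if (n < N)%N then y n else 0.

Lemma hproj_sum n N (y : nat -> H) : (forall n, Hn n (y n)) ->
  hproj n (\sum_(m < N) y m) = if (n < N)%N then y n else 0.
Proof.
move=> hy; rewrite /hproj; case: cid => M hM /=; case: cid2 => z hz e /=.
exact: decomposition_uniq.
Qed.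

Lemma hproj_in n a : Hn n (hproj n a).
Proof.
have [N [y hy ->]] := deg_lt_ex hg a.
by rewrite hproj_sum //; case: ifP => // _; exact: hom0.
Qed.

Lemma hproj_linear n : linear (hproj n).
Proof.
move=> k u v; have [N [y hy ->]] := deg_lt_ex hg u.
have [M [z hz ->]] := deg_lt_ex hg v.
pose T := maxn N M.
pose w n := k *: (if (n < N)%N then y n else 0) + (if (n < M)%N then z n else 0).
have hw m : Hn m (w m) by apply: (hom_compZD hg); case: ifP.
have -> : k *: (\sum_(m < N) y m) + \sum_(m < M) z m = \sum_(m < T) w m.
  rewrite /w big_split /= -scaler_sumr -!big_mkcond /=.
  by rewrite -(big_ord_widen T y) ?leq_maxl // -(big_ord_widen T z) ?leq_maxr.
rewrite !hproj_sum //; case: ifP => //; rewrite /T leq_max /w.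
by move=> /norP[/negbTE -> /negbTE ->]; rewrite scaler0 addr0.
Qed.

Lemma hproj_hom n m a : Hn m a -> hproj n a = if m == n then a else 0.
Proof.
move=> ha; pose y i := if i == m then a else 0.
have hy i : Hn i (y i) by rewrite /y; case: eqP => [->//|_]; exact: hom0.
have -> : a = \sum_(i < m.+1) y i.
  rewrite big_ord_recr /= {2}/y eqxx big1 ?add0r // => i _.
  by rewrite /y (ltn_eqF (ltn_ord i)).
rewrite hproj_sum // /y eq_sym; case: (eqVneq n m) => [->|nm].
  rewrite ltnSn big_ord_recr /= eqxx big1 ?add0r // => i _.
  by rewrite (ltn_eqF (ltn_ord i)).
by rewrite if_same.
Qed.

Lemma hom_ext (W : lmodType K) (f g : H -> W) : linear f -> linear g ->
  (forall n a, Hn n a -> f a = g a) -> f =1 g.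
Proof.
move=> lf lg h a; have [N [y hy ->]] := deg_lt_ex hg a.
by rewrite !lin_sum //; apply: eq_bigr => i _; exact: h (hy i).
Qed.

(** The degree zero component of 1 is a right unit, since multiplying by it computes
    the degree n component of h 1 for h homogeneous of degree n. *)
Lemma one_hom0 : Hn 0%N 1.
Proof.
have e n (h : H) : Hn n h -> h * hproj 0 1 = h.
  move=> hh; have [N [y hy e1]] := deg_lt_ex hg (1 : H).
  rewrite -[in RHS](mulr1 h) -[RHS](_ : hproj n (h * 1) = h * 1); last first.
    by rewrite mulr1 (hproj_hom _ hh) eqxx.
  rewrite e1 hproj_sum // mulr_sumr (lin_sum (hproj_linear n)).
  under eq_bigr => i _.
    have hi : Hn (n + i)%N (h * y i) by case: hg => _ hM _; exact: hM.
    rewrite (hproj_hom n hi) -[X in _ == X]addn0 eqn_add2l.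
    over.
  case: N e1 => [|N] _ /=; first by rewrite big_ord0 mulr0.
  by rewrite big_ord_recl /= big1 ?addr0.
suff -> : 1 = hproj 0 1 :> H by exact: hproj_in.
rewrite -[RHS]mul1r; symmetry.
apply: (hom_ext (f := fun a => a * hproj 0 1) (g := idfun)) => //.
by move=> k u v; rewrite mulrDl scalerAl.
Qed.

(** For a in degree n > 0, pair the coproduct with the counit on bidegree (n, 0)
    only.  By one counit law this is the counit of a, by the other one it is the
    counit of the degree zero component of a, which is 0. *)
Lemma counit_pos n a : (0 < n)%N -> Hn n a -> counit H a = 0.
Proof.
move=> n0 ha; case: (hg) => _ _ /(_ n a ha)[s [hs e]].
pose f (u v : H) : K^o := counit H (hproj n u) * counit H (hproj 0 v).
pose f1 (u v : H) : K^o := counit H (hproj n u) * counit H v.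
pose f2 (u v : H) : K^o := counit H u * counit H (hproj 0 v).
have lp m : linear (fun u => counit H (hproj m u) : K^o).
  by move=> k u v; rewrite hproj_linear linearP.
have lc : linear (fun u => counit H u : K^o) by exact: linearP.
have bil (g1 g2 : H -> K^o) : linear g1 -> linear g2 ->
    bilinear_map (fun u v => (g1 u * g2 v : K^o)).
  move=> l1 l2; split=> [v|u] k x y; first by rewrite l1 mulrDl -scalerAl.
  by rewrite l2 mulrDr -scalerAr.
have E1 : tlift f1 (comul H a) = counit H a.
  rewrite -{2}[a](_ : hproj n a = a); last by rewrite (hproj_hom n ha) eqxx.
  rewrite -{2}(counitr a) (tlift_comp _ _ (lp n)); apply: eq_tlift => u v.
  by rewrite (linZ (lp n)) /f1 mulrC.
have E2 : tlift f2 (comul H a) = 0.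
  transitivity (counit H (hproj 0 a)); last first.
    by rewrite (hproj_hom 0 ha) (gtn_eqF n0) linear0.
  rewrite -{2}(counitl a) (tlift_comp _ _ (lp 0%N)); apply: eq_tlift => u v.
  by rewrite (linZ (lp 0%N)).
rewrite -E1 -E2 e !tlift_sum; try exact: bil.
rewrite !big_seq; apply: eq_bigr => p /hs[k [l [kl hk hl]]].
rewrite !tlift_tens; try exact: bil.
rewrite /f1 /f2 (hproj_hom n hk) (hproj_hom 0 hl).
have [l0|l0] := eqVneq l 0%N.
  by have -> : k == n by rewrite -kl l0 addn0.
have -> : (k == n) = false.
  by apply/negbTE; rewrite -kl -{1}[k]addn0 eqn_add2l eq_sym.
by rewrite linear0 mulr0 mul0r.
Qed.

Lemma counit_hproj0 a : counit H (hproj 0 a) = counit H a.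
Proof.
apply: (@hom_ext K^o (fun a => counit H (hproj 0 a)) (counit H)).
- by move=> k u v; rewrite hproj_linear linearP.
- exact: linearP.
- move=> n h hh; rewrite (hproj_hom 0 hh); case: eqVneq => [//|n0].
  by rewrite linear0 (counit_pos _ hh) // lt0n.
Qed.

Lemma hproj0M a b : hproj 0 (a * b) = hproj 0 a * hproj 0 b.
Proof.
have lM (f : H -> H) c : linear f -> linear (fun a => f (a * c)).
  by move=> lf k u v; rewrite mulrDl -scalerAl lf.
have lM' (f : H -> H) c : linear f -> linear (fun a => f (c * a)).
  by move=> lf k u v; rewrite mulrDr -scalerAr lf.
have lp := hproj_linear 0.
apply: (hom_ext (f := fun a => hproj 0 (a * b)) (g := fun a => hproj 0 a * hproj 0 b)).
- exact: lM.
- by move=> k u v; rewrite lp mulrDl -scalerAl.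
move=> n {}a ha.
apply: (hom_ext (f := fun b => hproj 0 (a * b)) (g := fun b => hproj 0 a * hproj 0 b)).
- exact: lM'.
- by move=> k u v; rewrite lp mulrDr -scalerAr.
move=> m {}b hb; have hab : Hn (n + m)%N (a * b) by case: hg => _ hM _; exact: hM.
rewrite (hproj_hom 0 ha) (hproj_hom 0 hb) (hproj_hom 0 hab) addn_eq0.
by case: eqP => _; case: eqP => _ /=; rewrite ?mulr0 ?mul0r.
Qed.

End DegreeZero.

(** * The degree zero part carries no infinitesimal characters *)

Section Augmentation.
Context (K : numFieldType) (H : hopfAlgType K) (Hn : nat -> set H).
Context (hg : hopf_grading Hn) (hfin : finite_dim (Hn 0%N)) (B : comCiaType K).
Local Notation A := (homSpace H B).
Implicit Types (x y phi : A).

(** The Leibniz rule expands x^n(a^m) into products x^(n_1)(a) ... x^(n_m)(a) with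
    n_1 + ... + n_m = n.  Such a product vanishes if some n_i is 0, because x^0 is
    the counit; so n >= m, and for n = m all the n_i are 1. *)
Lemma inf_charX_diag x a : inf_characters x -> counit H a = 0 -> x a = 1 ->
  forall m, (forall k, (k < m)%N -> (x ^+ k : A) (a ^+ m) = 0) /\
    (x ^+ m : A) (a ^+ m) = m`!%:R.
Proof.
move=> hx a0 a1; elim=> [|m [ih1 ih2]].
  by split=> //; rewrite !expr0 hom1E counit1 scale1r.
have step n : (n <= m)%N -> (x ^+ n.+1 : A) (a ^+ m.+1) =
    (x ^+ n : A) (a ^+ m) *+ n.+1.
  move=> nm; rewrite [a ^+ _]exprS inf_charX // !big_ord_recl /= big1.
    rewrite expr0 hom1E a0 scale0r mul0r mul0rn add0r addr0.
    by rewrite /bump /= add1n expr1 a1 mul1r bin1 subSS subn0.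
  move=> i _; rewrite /bump /= !add1n subSS ih1 ?mulr0 ?mul0rn //.
  by apply: leq_trans nm; rewrite ltn_subLR // addSn ltnS leq_addl.
split=> [[_|k]|].
- by rewrite expr0 hom1E exprS counitM a0 mul0r scale0r.
- by rewrite ltnS => km; rewrite step ?ih1 ?mul0rn // ltnW.
- by rewrite step // ih2 factS mulnC natrM mulr_natr.
Qed.

Lemma hom0X a n : Hn 0%N a -> Hn 0%N (a ^+ n).
Proof.
move=> ha; elim: n => [|n ih]; first by rewrite expr0; exact: (one_hom0 hg).
by rewrite exprS -[0%N]/(0 + 0)%N; case: hg => _ hM _; exact: hM.
Qed.

Lemma hom0_dependent (f : nat -> H) : (forall i, Hn 0%N (f i)) ->
  exists d (u : 'I_d -> K), (exists i, u i != 0) /\ \sum_(i < d) u i *: f i = 0.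
Proof.
move=> hf; have [s [_ hs]] := hfin.
pose c i := sval (cid (hs _ (hf i))).
have hc i : f i = \sum_(j < size s) c i j *: s`_j by rewrite /c; case: cid.
pose C := \matrix_(i < (size s).+1, j < size s) c i j.
have : kermx C != 0.
  rewrite -mxrank_eq0 mxrank_ker -lt0n subn_gt0; apply: leq_ltn_trans (ltnSn _).
  exact: rank_leq_col.
move=> /rowV0Pn[u /sub_kermxP uC u0]; exists (size s).+1, (u 0); split.
  have /rV0Pn[i ui] := u0; by exists i.
under eq_bigr do rewrite hc scaler_sumr.
rewrite exchange_big /= big1 // => j _.
under eq_bigr do rewrite scalerA.
rewrite -scaler_suml; have /rowP/(_ j) := uC; rewrite !mxE => e.
rewrite (_ : \sum_i _ = 0) ?scale0r // -[RHS]e.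
by apply: eq_bigr => i _; rewrite mxE.
Qed.

Definition aug_square : set H := [set a | exists s : seq (H * H),
  (forall p, p \in s -> counit H p.1 = 0 /\ counit H p.2 = 0) /\
  a = \sum_(p <- s) p.1 * p.2].

Lemma aug_square_subspace : subspace_set aug_square.
Proof.
split; first by exists [::]; split=> //; rewrite big_nil.
move=> k _ _ [s [hs ->]] [t [ht ->]].
exists ([seq (k *: p.1, p.2) | p <- s] ++ t); split.
  move=> p; rewrite mem_cat => /orP[/mapP[q qs ->]|/ht//].
  by have [q1 q2] := hs _ qs; rewrite linearZ /= q1 scaler0.
rewrite big_cat big_map scaler_sumr; congr (_ + _).
by apply: eq_bigr => p _; rewrite scalerAl.
Qed.

(** A functional that separates a from the square of the augmentation ideal becomes
    an infinitesimal character after subtracting a multiple of the counit.  By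
    inf_charX_diag the powers of a would then be linearly independent. *)
Lemma hom0_aug_square a : (1 : B) != 0 -> Hn 0%N a -> counit H a = 0 -> aug_square a.
Proof.
move=> B1 ha a0; apply: contrapT => na.
have [f [lf fW fa]] := functional_ex aug_square_subspace na.
have ff (u v : H) : counit H u = 0 -> counit H v = 0 -> f (u * v) = 0.
  move=> u0 v0; apply: fW; exists [:: (u, v)]; split; last by rewrite big_seq1.
  by move=> p; rewrite inE => /eqP ->.
pose g u := f u - counit H u * f 1.
have lg : linear (fun u => g u *: (1 : B)).
  move=> k u v; rewrite scalerA -scalerDl; congr (_ *: _); rewrite /g lf linearP.
  by rewrite mulrDl mulrBr opprD addrACA -mulrA.
(* The scalar functional is viewed in B through the multiples of the unit. *)
pose x : A := mkHom lg.
have xE u : x u = g u *: (1 : B) by [].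
have gM u v : g (u * v) = counit H v * g u + counit H u * g v.
  pose u' := u - counit H u *: 1; pose v' := v - counit H v *: 1.
  have u'0 : counit H u' = 0.
    by rewrite /u' linearB linearZ /= counit1 -mulr_algl mulr1 scaler1 subrr.
  have v'0 : counit H v' = 0.
    by rewrite /v' linearB linearZ /= counit1 scaler1 subrr.
  have := ff _ _ u'0 v'0.
  rewrite /u' /v' mulrBl mulrBr -!scalerAl -!scalerAr mul1r mulr1.
  rewrite scalerBr !(linB lf) !(linZ lf) => e.
  have {}e : f (u * v) - counit H v * f u -
    (counit H u * f v - counit H u * (counit H v * f 1)) = 0 :> K := e.
  rewrite /g counitM; apply/eqP; rewrite -subr_eq0; apply/eqP; rewrite -[RHS]e.
  ring.
have hx : inf_characters x.
  by move=> u v; rewrite !xE !scalerA -scalerDl gM.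
have xa : x a = 1 by rewrite xE /g a0 mul0r subr0 fa scale1r.
(* Applying x^i to a linear relation isolates its lowest nonzero coefficient. *)
have [d [u [[i0 ui0] e]]] := hom0_dependent (f := fun i => a ^+ i) (fun i => @hom0X a i ha).
have [i ui imin] := @arg_minnP _ i0 (fun i => u i != 0) (fun i => i : nat) ui0.
have := congr1 (x ^+ i : A) e; rewrite raddf_sum linear0 (bigD1 i) //=.
rewrite linearZ /= (inf_charX_diag hx a0 xa i).2 big1 ?addr0; last first.
  move=> j ji; rewrite linearZ /=; have [->|uj] := eqVneq (u j) 0; first by rewrite scale0r.
  rewrite (inf_charX_diag hx a0 xa j).1 ?scaler0 //.
  by rewrite ltn_neqAle imin // andbT eq_sym.
rewrite -scaler_nat scalerA => /eqP; rewrite scaler_eq0 (negbTE B1) orbF.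
by rewrite mulf_eq0 (negbTE ui) pnatr_eq0 -leqn0 leqNgt fact_gt0.
Qed.

Lemma trivial_target (b : B) : (1 : B) = 0 -> b = 0.
Proof. by move=> h; rewrite -[b]mulr1 h mulr0. Qed.

Lemma inf_char_hom0 x a : inf_characters x -> Hn 0%N a -> x a = 0.
Proof.
move=> hx ha; have [B0|B1] := eqVneq (1 : B) 0; first exact: trivial_target.
pose a' := a - counit H a *: 1.
have ha' : Hn 0%N a'.
  by rewrite /a' addrC -scaleNr; apply: (hom_compZD hg) => //; exact: one_hom0 hg.
have a'0 : counit H a' = 0 by rewrite /a' linearB linearZ /= counit1 scaler1 subrr.
have [s [hs e]] := hom0_aug_square B1 ha' a'0.
rewrite -(subrK (counit H a *: 1) a) -/a' linearD linearZ /= inf_char1 //.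
rewrite scaler0 addr0 e (lin_sum (hom_linear x)) big_seq big1 // => p /hs[p1 p2].
by rewrite hx p1 p2 !scale0r addr0.
Qed.

Lemma inf_char_filt1 x : inf_characters x -> filt Hn 1 x.
Proof. by move=> hx m a; rewrite ltnS leqn0 => /eqP -> /inf_char_hom0; apply. Qed.

(** Equality of the augmentation ideal of degree zero with its square, in the form
    required by the determinant trick: the generators t are combinations of
    themselves with coefficients r in the ideal. *)
Lemma aug_generators : (1 : B) != 0 -> exists d (t : 'I_d -> H) (r : 'I_d -> 'I_d -> H),
  [/\ forall i j, counit H (r i j) = 0,
      forall i, t i = \sum_j r i j * t j
    & forall a, Hn 0%N a -> exists c : 'I_d -> K,
        a = counit H a *: 1 + \sum_i c i *: t i].
Proof.
move=> B1; have [s [hs sp]] := hfin.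
pose t (i : 'I_(size s)) := s`_i - counit H s`_i *: 1.
have ht i : Hn 0%N (t i).
  rewrite /t addrC -scaleNr; apply: (hom_compZD hg); first exact: one_hom0 hg.
  by apply: hs; exact: mem_nth.
have t0 i : counit H (t i) = 0 by rewrite /t linearB linearZ /= counit1 scaler1 subrr.
have span a : Hn 0%N a -> exists c : 'I_(size s) -> K,
        a = counit H a *: 1 + \sum_i c i *: t i.
  move=> ha; have [c e] := sp a ha; exists (fun i => c i).
  rewrite /t; under [in RHS]eq_bigr do rewrite scalerBr scalerA.
  have es : \sum_(i < size s) c i * counit H s`_i = counit H a.
    by rewrite e linear_sum; apply: eq_bigr => i _; rewrite linearZ.
  by rewrite sumrB -e -scaler_suml es addrC subrK.
have ex i : exists r : 'I_(size s) -> H, (forall j, counit H (r j) = 0) /\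
    t i = \sum_j r j * t j.
  have [u [hu e]] := hom0_aug_square B1 (ht i) (t0 i).
  (* Projecting to degree zero brings both factors of each product into H_0. *)
  have {}e : t i = \sum_(p <- u) hproj hg 0 p.1 * hproj hg 0 p.2.
    rewrite -[LHS](_ : hproj hg 0 (t i) = t i); last by rewrite (hproj_hom hg 0 (ht i)).
    rewrite e (lin_sum (hproj_linear hg 0)); apply: eq_bigr => p _; exact: hproj0M.
  rewrite {}e; elim: u hu => [|p u ih] hu.
    exists (fun=> 0); split=> [j|]; first by rewrite linear0.
    by rewrite big_nil big1 // => j _; rewrite mul0r.
  have [|r [hr er]] := ih; first by move=> q qu; apply: hu; rewrite inE qu orbT.
  have [p1 p2] := hu p (mem_head _ _).
  have [c ec] := span _ (hproj_in hg 0 p.2).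
  rewrite (counit_hproj0 hg) p2 scale0r add0r in ec.
  exists (fun j => c j *: hproj hg 0 p.1 + r j); split=> [j|].
    by rewrite linearP (counit_hproj0 hg) p1 hr scaler0 addr0.
  rewrite big_cons er ec mulr_sumr -big_split /=; apply: eq_bigr => j _.
  by rewrite mulrDl -scalerAl -scalerAr.
pose r i := sval (cid (ex i)).
have hr i : (forall j, counit H (r i j) = 0) /\ t i = \sum_j r i j * t j.
  by rewrite /r; case: cid.
by exists (size s), t, r; split=> // [i j|i]; have [h1 h2] := hr i.
Qed.

(** Nakayama's argument: the vector of the phi (t i) is killed by a matrix with
    invertible determinant. *)
Lemma char_det_filt1 d (t : 'I_d -> H) (r : 'I_d -> 'I_d -> H) phi :
  (forall i, t i = \sum_j r i j * t j) ->
  (forall a, Hn 0%N a -> exists c : 'I_d -> K,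
        a = counit H a *: 1 + \sum_i c i *: t i) ->
  characters phi ->
  ring_units (\det (1%:M - \matrix_(i, j) phi (r i j)) : B) ->
  filt Hn 1 (phi - 1).
Proof.
move=> ht hspan [phiM phi1] [u [_ hu]].
have phit i : phi (t i) = 0.
  pose M : 'M[B]_d := 1%:M - \matrix_(i, j) phi (r i j).
  pose v : 'cV[B]_d := \col_i phi (t i).
  have Mv : M *m v = 0.
    apply/colP => k; rewrite /M mulmxBl mul1mx !mxE ht raddf_sum /=.
    apply/eqP; rewrite subr_eq0; apply/eqP/eq_bigr => j _.
    by rewrite phiM !mxE.
  have : \adj M *m (M *m v) = 0 by rewrite Mv mulmx0.
  rewrite mulmxA mul_adj_mx mul_scalar_mx => /colP/(_ i); rewrite !mxE => e.
  by rewrite -[LHS]mul1r -hu -mulrA e mulr0.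
move=> m a; rewrite ltnS leqn0 => /eqP -> /hspan[c e].
rewrite homBE hom1E {1}e linearD linearZ /= phi1 (lin_sum (hom_linear phi)).
rewrite big1 ?addr0 ?subrr // => i _.
by rewrite linearZ /= phit scaler0.
Qed.

End Augmentation.

(** * Linear subspaces of locally convex spaces *)

Section SubTvs.
Context (K : numFieldType) (V : tvsType K) (P : set V) (sP : subspace_set P).

(** The proof that P is a subspace is an argument of the type so that the vector
    space structure can be found by inference. *)
Definition sub_tvs of subspace_set P : Type := set_type P.
Local Notation W := (sub_tvs sP).

HB.instance Definition _ := Topological.on W.

Definition sub_val (x : W) : V := set_val x.

Lemma sub_valP x : P (sub_val x). Proof. exact: (set_mem (valP x)). Qed.

Lemma sub_val_inj : injective sub_val. Proof. exact: val_inj. Qed.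

Definition mkSub v (hv : P v) : W := exist _ v (mem_set hv).

Lemma mkSubK v (hv : P v) : sub_val (mkSub hv) = v. Proof. by []. Qed.

Let P0 : P 0. Proof. by case: sP. Qed.
Let PD x y : P x -> P y -> P (x + y).
Proof. by move=> Px Py; rewrite -[x]scale1r; case: sP => _; apply. Qed.
Let PZ k x : P x -> P (k *: x).
Proof. by move=> Px; rewrite -[_ *: _]addr0; case: sP => _; apply. Qed.

Definition sub_zero := mkSub P0.
Definition sub_add x y := mkSub (PD (sub_valP x) (sub_valP y)).
Definition sub_scale k x := mkSub (PZ k (sub_valP x)).
Definition sub_opp x := sub_scale (-1) x.

Fact sub_addA : associative sub_add.
Proof. by move=> x y z; apply: sub_val_inj; exact: addrA. Qed.
Fact sub_addC : commutative sub_add.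
Proof. by move=> x y; apply: sub_val_inj; exact: addrC. Qed.
Fact sub_add0 : left_id sub_zero sub_add.
Proof. by move=> x; apply: sub_val_inj; exact: add0r. Qed.
Fact sub_addN : left_inverse sub_zero sub_opp sub_add.
Proof.
move=> x; apply: sub_val_inj.
by change (-1 *: sub_val x + sub_val x = 0); rewrite scaleN1r addNr.
Qed.

HB.instance Definition _ :=
  GRing.isZmodule.Build W sub_addA sub_addC sub_add0 sub_addN.

Fact sub_scaleA a b x : sub_scale a (sub_scale b x) = sub_scale (a * b) x.
Proof. by apply: sub_val_inj; exact: scalerA. Qed.
Fact sub_scale1 : left_id 1 sub_scale.
Proof. by move=> x; apply: sub_val_inj; exact: scale1r. Qed.
Fact sub_scaleDr : right_distributive sub_scale sub_add.
Proof. by move=> k x y; apply: sub_val_inj; exact: scalerDr. Qed.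
Fact sub_scaleDl x : {morph sub_scale^~ x : a b / a + b >-> sub_add a b}.
Proof. by move=> a b; apply: sub_val_inj; exact: scalerDl. Qed.

HB.instance Definition _ := GRing.Zmodule_isLmodule.Build K W
  sub_scaleA sub_scale1 sub_scaleDr sub_scaleDl.

Lemma sub_val_linear : linear sub_val. Proof. by []. Qed.

Lemma sub_val_continuous : continuous sub_val.
Proof. exact: (@initial_continuous W V set_val). Qed.

Lemma sub_cvgP (F : set_system W) (x : W) : Filter F ->
  (F --> x) <-> (sub_val @ F --> sub_val x).
Proof.
move=> FF; split=> [h|hv]; first exact: cvg_trans (cvg_app _ h) (@sub_val_continuous x).
move=> U [_ [[Q oQ <-] Qx] QU]; apply: filterS QU _.
by apply: hv; exact: open_nbhs_nbhs.
Qed.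

Fact sub_add_continuous : continuous (fun p : W * W => p.1 + p.2).
Proof.
move=> p; apply/sub_cvgP.
have hf : (fun q : W * W => sub_val q.1) @ nbhs p --> sub_val p.1.
  apply: (@cvg_comp _ _ _ _ sub_val _ (nbhs (p.1 : W))); first exact: cvg_fst.
  exact: sub_val_continuous.
have hg : (fun q : W * W => sub_val q.2) @ nbhs p --> sub_val p.2.
  apply: (@cvg_comp _ _ _ _ sub_val _ (nbhs (p.2 : W))); first exact: cvg_snd.
  exact: sub_val_continuous.
exact: (continuous2_cvg _ (@add_continuous V (sub_val p.1, sub_val p.2)) hf hg).
Qed.

Fact sub_scale_continuous : continuous (fun p : K^o * W => p.1 *: p.2).
Proof.
move=> p; apply/sub_cvgP.
have hf : fst @ nbhs p --> p.1 by exact: cvg_fst.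
have hg : (fun q : K^o * W => sub_val q.2) @ nbhs p --> sub_val p.2.
  apply: (@cvg_comp _ _ _ _ sub_val _ (nbhs (p.2 : W))); first exact: cvg_snd.
  exact: sub_val_continuous.
exact: (continuous2_cvg _ (@scale_continuous K V (p.1, sub_val p.2)) hf hg).
Qed.

Fact sub_locally_convex : exists2 S : set_system W,
  (forall b, b \in S -> convex_set b) & basis S.
Proof.
have [S Sc [So Sb]] := @locally_convex K V.
exists [set U | exists2 b, S b & U = sub_val @^-1` b].
  move=> U /set_mem[b Sb' ->] x y l; rewrite !inE => bx by_.
  have := Sc b (mem_set Sb') (sub_val x) (sub_val y) l; rewrite !inE; exact.
split=> [_ [b /So ob ->]|x].
  by apply: open_comp => // ? _; exact: sub_val_continuous.
move=> U [_ [[Q oQ <-] Qx] QU].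
have /Sb [b [Sb' bx] bQ] : nbhs (sub_val x) Q by exact: open_nbhs_nbhs.
exists (sub_val @^-1` b); last by move=> y /bQ; exact: QU.
by split=> //; exists b.
Qed.

HB.instance Definition _ := PreTopologicalLmod_isTvs.Build K W
  sub_add_continuous sub_scale_continuous sub_locally_convex.
HB.instance Definition _ :=
  PreTopologicalNmodule_isTopologicalNmodule.Build W sub_add_continuous.
HB.instance Definition _ :=
  TopologicalNmodule_isTopologicalLmodule.Build K W sub_scale_continuous.
HB.instance Definition _ := Uniform_isTvs.Build K W sub_locally_convex.

End SubTvs.

(** * Curves with values in the target algebra *)

Section TargetCalculus.
Context (K : numFieldType) (B : comCiaType K).
Implicit Types (q r : K -> B).

Section Limits.
Context (T : Type) (F : set_system T) {FF : Filter F}.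
Implicit Types (f g : T -> B).

Lemma cvg_addB f g (a b : B) : f @ F --> a -> g @ F --> b -> (fun t => f t + g t) @ F --> a + b.
Proof. exact: (continuous2_cvg _ (@add_continuous B (a, b))). Qed.

Lemma cvg_mulB f g (a b : B) : f @ F --> a -> g @ F --> b -> (fun t => f t * g t) @ F --> a * b.
Proof. exact: (continuous2_cvg _ (@topalg_mul_continuous K B (a, b))). Qed.

Lemma cvg_scaleB (s : T -> K^o) f (k : K^o) (a : B) :
  s @ F --> k -> f @ F --> a -> (fun t => (s t : K) *: f t) @ F --> (k : K) *: a.
Proof. exact: (continuous2_cvg _ (@scale_continuous K B (k, a))). Qed.

Lemma cvg_cstB (a : B) : (fun=> a) @ F --> a. Proof. exact: cvg_cst. Qed.

Lemma cvg_sumB (I : Type) (s : seq I) (P : pred I) (f : I -> T -> B) (a : I -> B) :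
  (forall i, P i -> f i @ F --> a i) ->
  (fun t => \sum_(i <- s | P i) f i t) @ F --> \sum_(i <- s | P i) a i.
Proof.
move=> h; elim: s => [|i s ih].
  rewrite big_nil; under eq_fun do rewrite big_nil; exact: cvg_cstB.
rewrite big_cons; under eq_fun do rewrite big_cons.
by case: ifP => // Pi; apply: cvg_addB => //; exact: h.
Qed.

Lemma cvg_prodB (I : Type) (s : seq I) (P : pred I) (f : I -> T -> B) (a : I -> B) :
  (forall i, P i -> f i @ F --> a i) ->
  (fun t => \prod_(i <- s | P i) f i t) @ F --> \prod_(i <- s | P i) a i.
Proof.
move=> h; elim: s => [|i s ih].
  rewrite big_nil; under eq_fun do rewrite big_nil; exact: cvg_cstB.
rewrite big_cons; under eq_fun do rewrite big_cons.
by case: ifP => // Pi; apply: cvg_mulB => //; exact: h.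
Qed.

Lemma cvg_detB d (M : T -> 'M[B]_d) (L : 'M[B]_d) :
  (forall i j, (fun t => M t i j) @ F --> L i j) ->
  (fun t => \det (M t)) @ F --> (\det L : B).
Proof.
move=> h; apply: cvg_sumB => s _; apply: cvg_mulB; first exact: cvg_cstB.
by apply: cvg_prodB => i _; exact: h.
Qed.

End Limits.

(** The derivative at 0 of a curve with values in B; derivatives of maps into spaces
    of linear maps reduce to it by evaluation. *)
Definition cderiv q (l : B) :=
  (fun h : K^o => (h : K)^-1 *: (q h - q 0)) @ (0 : K^o)^' --> l.

Lemma eq_cderiv q r l m : q =1 r -> l = m -> cderiv q l -> cderiv r m.
Proof. by move=> /funext -> ->. Qed.

Lemma cderiv_uniq q l l' : cderiv q l -> cderiv q l' -> l = l'.
Proof. exact: (@cvg_unique B (@cia_hausdorff K B)). Qed.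

Lemma cderiv_affine (a b : B) : cderiv (fun h => a + h *: b) b.
Proof.
apply: cvg_near_cst; near=> h.
rewrite scale0r addr0 addrC addKr scalerA mulVf ?scale1r //.
by near: h; exact: nbhs_dnbhs_neq.
Unshelve. all: by end_near. Qed.

Lemma cderiv_cst (a : B) : cderiv (fun=> a) 0.
Proof. by rewrite /cderiv; under eq_fun do rewrite subrr scaler0; exact: cvg_cst. Qed.

Lemma cderivD q r l m : cderiv q l -> cderiv r m -> cderiv (fun h => q h + r h) (l + m).
Proof.
move=> hq hr; rewrite /cderiv; under eq_fun do rewrite opprD addrACA scalerDr.
exact: cvg_addB.
Qed.

(** No junk arises at h = 0 since 0 times the difference quotient is 0. *)
Lemma cderiv_cont q l : cderiv q l -> (q : K^o -> B) @ (0 : K^o)^' --> q 0.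
Proof.
move=> hq; have -> : q = fun h => q 0 + h *: (h^-1 *: (q h - q 0)).
  apply/funext => h; have [->|h0] := eqVneq h 0; first by rewrite scale0r addr0.
  by rewrite scalerA mulfV // scale1r addrC subrK.
rewrite -[X in _ --> X]addr0 -(scale0r l) subrr scaler0 scaler0 addr0.
apply: cvg_addB; first exact: cvg_cstB.
apply: (cvg_scaleB (s := idfun)) => //.
by apply: cvg_within.
Qed.

Lemma cderivM q r l m : cderiv q l -> cderiv r m ->
  cderiv (fun h => q h * r h) (l * r 0 + q 0 * m).
Proof.
move=> hq hr; rewrite /cderiv.
have -> : (fun h : K^o => (h : K)^-1 *: (q h * r h - q 0 * r 0)) =
  fun h => (h^-1 *: (q h - q 0)) * r h + q 0 * (h^-1 *: (r h - r 0)).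
  apply/funext => h; rewrite -topalg_scalerAl -topalg_scalerAr -scalerDr.
  by rewrite mulrBl mulrBr addrA subrK.
apply: cvg_addB; apply: cvg_mulB => //; last exact: cvg_cstB.
exact: cderiv_cont hr.
Qed.

Lemma cderivZ k q l : cderiv q l -> cderiv (fun h => k *: q h) (k *: l).
Proof.
move=> hq; rewrite /cderiv.
under eq_fun do rewrite -scalerBr scalerA mulrC -scalerA.
by apply: (cvg_scaleB (s := fun=> k)) => //; exact: cvg_cst.
Qed.

Lemma cderiv_sum (I : Type) (s : seq I) (q : I -> K -> B) (l : I -> B) :
  (forall i, cderiv (q i) (l i)) ->
  cderiv (fun h => \sum_(i <- s) q i h) (\sum_(i <- s) l i).
Proof.
move=> h; elim: s => [|i s ih].
  by rewrite big_nil; under eq_fun do rewrite big_nil; exact: cderiv_cst.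
by rewrite big_cons; under eq_fun do rewrite big_cons; exact: cderivD.
Qed.

End TargetCalculus.

(** * Polynomial maps are smooth *)

Section DirectionalDerivatives.
Context (K : numFieldType) (E F : tvsType K) (hF : hausdorff_space F).

Lemma is_dderiv_uniq (f : E -> F) x v l l' :
  is_dderiv f x v l -> is_dderiv f x v l' -> l = l'.
Proof. exact: (@cvg_unique F hF). Qed.

Lemma dderivE (f : E -> F) x v l : is_dderiv f x v l -> dderiv f v x = l.
Proof.
move=> hl; apply: is_dderiv_uniq (hl).
exact: (@xgetPex _ 0 [set l | is_dderiv f x v l] (ex_intro _ l hl)).
Qed.

Lemma smooth_on0 (f : E -> F) : smooth_on set0 f.
Proof. by split=> //; exact: open0. Qed.

End DirectionalDerivatives.

Section PolynomialMaps.
Context (K : numFieldType) (B : comCiaType K).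

Section PolyFun.
Context (E : tvsType K).
Implicit Types (e : nat -> E) (f g : (nat -> E) -> B).

(** Polynomials in continuous linear functions of a sequence of vectors.  Index 0 is
    the point at which a map is differentiated, and later indices are the
    directions; treating them alike makes the class stable under differentiation
    and gives joint continuity of the higher differentials. *)
Inductive polyfun : ((nat -> E) -> B) -> Prop :=
| polyfun_cst b : polyfun (fun=> b)
| polyfun_lin (l : E -> B) i : linear l -> continuous l -> polyfun (fun e => l (e i))
| polyfun_add f g : polyfun f -> polyfun g -> polyfun (fun e => f e + g e)
| polyfun_mul f g : polyfun f -> polyfun g -> polyfun (fun e => f e * g e).

Lemma polyfun_cvg f : polyfun f -> forall (T : Type) (F : set_system T) (FF : Filter F)
  (u : T -> nat -> E) e, (forall n, (fun t => u t n) @ F --> e n) ->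
  (fun t => f (u t)) @ F --> f e.
Proof.
move=> pf T F FF u e hu; elim: pf => {f}.
- by move=> b; exact: cvg_cst.
- by move=> l i _ lc; exact: (cvg_comp _ _ (hu i) (lc (e i))).
- by move=> f g _ hf _ hg; exact: cvg_addB.
- by move=> f g _ hf _ hg; exact: cvg_mulB.
Qed.

(** Moving the base point along v while keeping the directions. *)
Definition shift_env e (v : E) (h : K) : nat -> E :=
  fun n => if n is 0 then e 0%N + h *: v else e n.

Lemma shift_env0 e v : shift_env e v 0 = e.
Proof. by apply/funext => -[|n] //=; rewrite scale0r addr0. Qed.

Lemma polyfun_deriv f j : polyfun f -> exists2 g, polyfun g &
  forall e, cderiv (fun h => f (shift_env e (e j) h)) (g e).
Proof.
elim=> {f}.
- by move=> b; exists (fun=> 0) => [|e]; [exact: polyfun_cst|exact: cderiv_cst].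
- move=> l [|i] ll lc.
    exists (fun e => l (e j)) => [|e]; first exact: polyfun_lin.
    have -> : (fun h => l (shift_env e (e j) h 0%N)) = (fun h => l (e 0%N) + h *: l (e j)).
      by apply/funext => h; rewrite /= (linD ll) (linZ ll).
    exact: cderiv_affine.
  by exists (fun=> 0) => [|e]; [exact: polyfun_cst|exact: (@cderiv_cst _ _ (l (e i.+1)))].
- move=> f g _ [f' pf' hf'] _ [g' pg' hg'].
  by exists (fun e => f' e + g' e) => [|e]; [exact: polyfun_add|exact: cderivD].
- move=> f g pf [f' pf' hf'] pg [g' pg' hg'].
  exists (fun e => f' e * g e + f e * g' e) => [|e].
    by apply: polyfun_add; exact: polyfun_mul.
  by have := cderivM (hf' e) (hg' e); rewrite !shift_env0.
Qed.

Lemma polyfun_sum (I : Type) (s : seq I) (f : I -> (nat -> E) -> B) :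
  (forall i, polyfun (f i)) -> polyfun (fun e => \sum_(i <- s) f i e).
Proof.
move=> hf; elim: s => [|i s ih].
  by under eq_fun do rewrite big_nil; exact: polyfun_cst.
by under eq_fun do rewrite big_cons; exact: polyfun_add.
Qed.

Lemma polyfun_scale k f : polyfun f -> polyfun (fun e => k *: f e).
Proof.
move=> pf; have -> : (fun e => k *: f e) = (fun e => (k *: (1 : B) : B) * f e).
  by apply/funext => e; rewrite -topalg_scalerAl mul1r.
exact/polyfun_mul/pf/polyfun_cst.
Qed.

End PolyFun.

(** The target F is a space of linear maps with the topology of pointwise
    convergence, closed under pointwise limits.  Closedness is what allows
    derivatives to be computed value by value. *)
Record pointwise_embedding (H : lmodType K) (F : tvsType K) (i : F -> homSpace H B) : Prop :=
  PointwiseEmbedding {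
    emb_linear : linear i;
    emb_inj : injective i;
    emb_cvg : forall (S : set_system F) (x : F), Filter S ->
      (forall a, (fun y => i y a) @ S --> i x a) -> S --> x;
    emb_cont : forall a, continuous (fun y : F => i y a : B);
    emb_closed : forall (T : Type) (S : set_system T) (u : T -> F) (l : H -> B),
      ProperFilter S -> (forall a, (fun t => i (u t) a) @ S --> l a) ->
      exists x, forall a, i x a = l a
  }.

Lemma hausdorff_separated (I : Type) (T : topologicalType) (f : I -> T -> B) :
  (forall i, continuous (f i)) -> (forall x y, (forall i, f i x = f i y) -> x = y) ->
  hausdorff_space T.
Proof.
move=> fc sep x y cxy; apply: sep => i; apply: (@cia_hausdorff K B) => P Q hP hQ.
have [z [zP zQ]] := cxy _ _ (fc i x _ hP) (fc i y _ hQ).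
by exists (f i z).
Qed.

Section Smooth.
Context (H : lmodType K) (E F : tvsType K) (i : F -> homSpace H B).
Context (hi : pointwise_embedding i).

Lemma emb_hausdorff : hausdorff_space F.
Proof.
apply: (hausdorff_separated (f := fun a y => i y a)); first exact: emb_cont.
by move=> x y h; apply: (emb_inj hi); exact: homP.
Qed.

Let quotient_eval (f : E -> F) x v a (h : K) :
  i (h^-1 *: (f (x + h *: v) - f x)) a =
  h^-1 *: (i (f (x + h *: v)) a - i (f (x + 0 *: v)) a).
Proof.
by rewrite scale0r addr0 (linZ (emb_linear hi)) (linB (emb_linear hi)) homZE homBE.
Qed.

Lemma is_dderiv_pointwise (f : E -> F) x v l :
  is_dderiv f x v l <-> forall a, cderiv (fun h => i (f (x + h *: v)) a) (i l a).
Proof.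
split=> h => [a|].
  rewrite /cderiv; under eq_fun do rewrite -quotient_eval.
  exact: (cvg_comp _ _ h (@emb_cont _ _ _ hi a l)).
apply: (emb_cvg hi) => a; have := h a; rewrite /cderiv.
by under eq_fun do rewrite -quotient_eval.
Qed.

(** If all values of f have derivatives along v, these values form an element of F,
    and it is the directional derivative of f. *)
Lemma dderiv_pointwise (f : E -> F) x v (L : H -> B) :
  (forall a, cderiv (fun h => i (f (x + h *: v)) a) (L a)) ->
  is_dderiv f x v (dderiv f v x) /\ forall a, i (dderiv f v x) a = L a.
Proof.
move=> hL.
have [l hl] : exists l, forall a, i l a = L a.
  apply: (@emb_closed _ _ _ hi _ (0 : K^o)^' (fun h : K^o => (h : K)^-1 *: (f (x + h *: v) - f x))).
  by move=> a; have := hL a; rewrite /cderiv; under eq_fun do rewrite -quotient_eval.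
have dl : is_dderiv f x v l by apply/is_dderiv_pointwise => a; rewrite hl.
by rewrite (dderivE emb_hausdorff dl).
Qed.

(** Only the entry of index 0 of the sequence matters here, but stating it for
    sequences lets the derivatives be expressed in the same terms. *)
Definition polymap (f : E -> F) := forall a, exists2 g, polyfun g &
  forall e : nat -> E, i (f (e 0%N)) a = g e.

Local Notation iter_env f k e := (iter_dderiv f (mkseq (fun m => e m.+1) k)).

Let iter_env_deriv (f : E -> F) k :
  (forall a, exists2 g, polyfun g & forall e, i (iter_env f k e (e 0%N)) a = g e) ->
  exists2 G : H -> (nat -> E) -> B, forall a, polyfun (G a) & forall e,
    is_dderiv (iter_env f k e) (e 0%N) (e k.+1) (dderiv (iter_env f k e) (e k.+1) (e 0%N)) /\
    forall a, i (dderiv (iter_env f k e) (e k.+1) (e 0%N)) a = G a e.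
Proof.
move=> hf; pose g a := s2val (cid2 (hf a)).
have pg a : polyfun (g a) by rewrite /g; case: cid2.
have hg a e : i (iter_env f k e (e 0%N)) a = g a e by rewrite /g; case: cid2.
pose G a := s2val (cid2 (polyfun_deriv k.+1 (pg a))).
have hG a e : cderiv (fun h => g a (shift_env e (e k.+1) h)) (G a e).
  by rewrite /G; case: cid2.
exists G => [a|e]; first by rewrite /G; case: cid2.
apply: dderiv_pointwise => a.
have -> : (fun h => i (iter_env f k e (e 0%N + h *: e k.+1)) a) =
  (fun h => g a (shift_env e (e k.+1) h)) by apply/funext => h; rewrite -hg.
exact: hG.
Qed.

Let polymap_iter (f : E -> F) : polymap f -> forall k a, exists2 g, polyfun g &
  forall e, i (iter_env f k e (e 0%N)) a = g e.
Proof.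
move=> pf; elim=> [|k ih] a; first exact: pf.
have [G pG hG] := iter_env_deriv ih; exists (G a) => // e.
by rewrite mkseqS /iter_dderiv foldl_rcons; have [_] := hG e; apply.
Qed.

(** Each iterated derivative is polynomial in the base point and the directions
    together, by induction on the number of directions; hence it is again
    differentiable, and jointly continuous. *)
Lemma polymap_smooth (f : E -> F) : polymap f -> smooth_on setT f.
Proof.
move=> pf; split; first exact: openT.
- move=> ys x v _; exists (dderiv (iter_dderiv f ys) v x).
  pose e := nth 0 (x :: rcons ys v).
  have ee : mkseq (fun m => e m.+1) (size ys) = ys.
    apply: (@eq_from_nth _ 0); rewrite size_mkseq // => n nk.
    by rewrite nth_mkseq // /e /= nth_rcons nk.
  have ev : e (size ys).+1 = v by rewrite /e /= nth_rcons ltnn eqxx.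
  have [G _ /(_ e)[]] := iter_env_deriv (polymap_iter pf (size ys)).
  by rewrite ee ev.
- move=> k x ys _; apply: (emb_cvg hi) => a.
  have [g pg hg] := polymap_iter pf k a.
  pose e (p : E * {ptws 'I_k -> E}) : nat -> E := nth 0 (p.1 :: [seq p.2 j | j <- enum 'I_k]).
  have ge p : i (iter_diff f p) a = g (e p).
    rewrite -hg /iter_diff; congr (hom_fun (i (iter_dderiv f _ _)) a).
    apply: (@eq_from_nth _ 0); rewrite size_map size_enum_ord ?size_mkseq // => n nk.
    by rewrite nth_mkseq.
  rewrite ge; suff : (fun p => g (e p)) @ nbhs (x, ys) --> g (e (x, ys)).
    have -> : (fun p => g (e p)) = (fun y => i y a : B) \o iter_diff f.
      by apply/funext => p; rewrite /= ge.
    exact.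
  apply: (polyfun_cvg pg) => -[|n]; first exact: cvg_fst.
  rewrite /e /=; have [nk|kn] := ltnP n k; last first.
    have dflt (p : {ptws 'I_k -> E}) : nth 0 [seq p j | j <- enum 'I_k] n = 0.
      by apply: nth_default; rewrite size_map size_enum_ord.
    by rewrite dflt; apply: cvg_near_cst; apply: nearW => p; exact: dflt.
  have ne (p : {ptws 'I_k -> E}) : nth 0 [seq p j | j <- enum 'I_k] n = p (Ordinal nk).
    rewrite (nth_map (Ordinal nk)) ?size_enum_ord //; congr (p _); apply: val_inj.
    by rewrite /= nth_enum_ord.
  have -> : (fun p : E * {ptws 'I_k -> E} => nth 0 [seq p.2 j | j <- enum 'I_k] n) =
      (fun p => p.2 (Ordinal nk)) by apply/funext => p; rewrite ne.
  rewrite ne; apply: (@cvg_comp _ _ _ _ (fun p : {ptws 'I_k -> E} => p (Ordinal nk)) _ (nbhs ys)).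
    exact: cvg_snd.
  exact: (@proj_continuous 'I_k (fun=> E)).
Qed.

End Smooth.

End PolynomialMaps.

(** * Polynomial maps into Hom(H, B) and its subspaces *)

Section Embeddings.
Context (K : numFieldType) (B : comCiaType K) (H : lmodType K).
Local Notation A := (homSpace H B).

Lemma hom_embedding : pointwise_embedding (id : A -> A).
Proof.
split=> //.
- by move=> S x FS h; apply/hom_cvgP.
- by move=> a; exact: hom_eval_continuous.
move=> T S u l FS h.
have ll : linear l.
  move=> k a b; apply: (@cvg_unique B (@cia_hausdorff K B) _ _ _ _ (h (k *: a + b))).
  have e : (fun t => (u t : A) (k *: a + b)) = (fun t => k *: (u t : A) a + (u t : A) b).
    by apply/funext => t; exact: hom_linear.
  rewrite /= e.
  by apply: cvg_addB => //; apply: (cvg_scaleB (s := fun=> k)) => //; exact: cvg_cst.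
by exists (mkHom ll).
Qed.

Lemma sub_embedding (P : set A) (sP : subspace_set P) :
  (forall (T : Type) (S : set_system T) (u : T -> A) (l : A), ProperFilter S ->
    (forall t, P (u t)) -> (forall a, (fun t => u t a) @ S --> l a) -> P l) ->
  pointwise_embedding (@sub_val K A P sP).
Proof.
move=> cP; split.
- exact: sub_val_linear.
- exact: sub_val_inj.
- by move=> S x FS h; apply/sub_cvgP/hom_cvgP.
- move=> a x; apply: (@continuous_comp _ _ _ (@sub_val K A P sP) (fun f : A => f a : B)).
    exact: sub_val_continuous.
  exact: hom_eval_continuous.
move=> T S u l FS h; have [f hf] := emb_closed hom_embedding FS h.
have Pf : P f.
  apply: (cP T S (fun t => sub_val (u t))) => [t|a]; first exact: sub_valP.
  by rewrite hf; exact: h.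
by exists (mkSub sP Pf) => a; rewrite mkSubK hf.
Qed.

End Embeddings.

Section ConvolutionLimits.
Context (K : numFieldType) (H : hopfAlgType K) (B : comCiaType K).
Local Notation A := (homSpace H B).

Lemma conv_cvg (T : Type) (S : set_system T) (FS : Filter S) (u v : T -> A) (x y : A) :
  (forall a, (fun t => u t a) @ S --> x a) -> (forall a, (fun t => v t a) @ S --> y a) ->
  forall a, (fun t => (u t * v t : A) a) @ S --> (x * y : A) a.
Proof.
move=> hu hv a; rewrite homME /tlift /tsum; apply: cvg_sumB => p _; exact: cvg_mulB.
Qed.

Lemma expX_cvg (T : Type) (S : set_system T) (FS : Filter S) (u : T -> A) (x : A) n :
  (forall a, (fun t => u t a) @ S --> x a) ->
  forall a, (fun t => (u t ^+ n : A) a) @ S --> (x ^+ n : A) a.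
Proof.
move=> hu; elim: n => [|n ih] a; first exact: cvg_cst.
by under eq_fun do rewrite exprS; rewrite exprS; exact: conv_cvg.
Qed.

Lemma inf_characters_subspace : subspace_set (@inf_characters K H B).
Proof.
split=> [a b|k x y hx hy a b]; first by rewrite !hom0E !scaler0 addr0.
by rewrite !homDE !homZE hx hy !scalerDr !scalerA addrACA ![k * _]mulrC.
Qed.

Lemma inf_characters_closed (T : Type) (S : set_system T) (u : T -> A) (l : A) :
  ProperFilter S -> (forall t, inf_characters (u t)) ->
  (forall a, (fun t => u t a) @ S --> l a) -> inf_characters l.
Proof.
move=> FS hu h a b; apply: (@cvg_unique B (@cia_hausdorff K B) _ _ _ _ (h (a * b))).
have e : (fun t => u t (a * b)) = (fun t => counit H b *: u t a + counit H a *: u t b).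
  by apply/funext => t; exact: hu.
rewrite /= e; apply: cvg_addB; apply: (cvg_scaleB (s := fun=> _)) => //; exact: cvg_cst.
Qed.

(** The model space of the Lie group. *)
Definition infSpace : tvsType K := sub_tvs inf_characters_subspace.
Definition inf_val (x : infSpace) : A := sub_val x.

Lemma inf_valP x : inf_characters (inf_val x). Proof. exact: sub_valP. Qed.

Lemma inf_embedding : pointwise_embedding inf_val.
Proof. apply: sub_embedding; exact: inf_characters_closed. Qed.

Section Filtered.
Context (Hn : nat -> set H) (hg : hopf_grading Hn).
Local Notation filt := (filt Hn).
Local Notation expo := (expo Hn).
Local Notation logt := (logt Hn).
Local Notation logo := (logo Hn).

(** Only values near the limit are required to lie in F_1: charts are continuous on
    an open set but are defined everywhere. *)
Lemma expo_cvg (T : Type) (S : set_system T) (FS : Filter S) (u : T -> A) (x : A) :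
  (\forall t \near S, filt 1 (u t)) -> filt 1 x ->
  (forall a, (fun t => u t a) @ S --> x a) ->
  forall a, (fun t => expo (u t) a) @ S --> expo x a.
Proof.
move=> nu hx hu a; have [n ha] := deg_lt_ex hg a.
rewrite (expo_eval hg hx ha).
apply: (@cvg_trans _ ((fun t => \sum_(k < n) (k`!%:R : K)^-1 *: (u t ^+ k : A) a) @ S)).
  by apply: near_eq_cvg; apply: filterS nu => t ht; rewrite (expo_eval hg ht ha).
apply: cvg_sumB => k _; apply: (cvg_scaleB (s := fun=> _)); first exact: cvg_cst.
exact: expX_cvg.
Qed.

Lemma logt_cvg n (T : Type) (S : set_system T) (FS : Filter S) (u : T -> A) (x : A) :
  (\forall t \near S, filt 1 (u t - 1)) -> filt 1 (x - 1) ->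
  (forall a, (fun t => u t a) @ S --> x a) ->
  forall a, (fun t => logt n (u t) a) @ S --> logt n x a.
Proof.
move=> nu hx hu; elim: n => [|n ih] a; first exact: cvg_cst.
apply: cvg_addB; first exact: ih.
under eq_fun do rewrite homBE; rewrite homBE.
apply: cvg_addB; first exact: hu.
rewrite -scaleN1r; under eq_fun do rewrite -scaleN1r.
apply: (cvg_scaleB (s := fun=> _)); first exact: cvg_cst.
apply: expo_cvg => //; last by have [] := logtP hg n hx.
by apply: filterS nu => t ht; have [] := logtP hg n ht.
Qed.

Lemma logo_cvg (T : Type) (S : set_system T) (FS : Filter S) (u : T -> A) (x : A) :
  (\forall t \near S, filt 1 (u t - 1)) -> filt 1 (x - 1) ->
  (forall a, (fun t => u t a) @ S --> x a) ->
  forall a, (fun t => logo (u t) a) @ S --> logo x a.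
Proof.
move=> nu hx hu a; have [n ha] := deg_lt_ex hg a.
rewrite (logo_eval hg hx ha).
apply: (@cvg_trans _ ((fun t => logt n (u t) a) @ S)); last exact: logt_cvg.
by apply: near_eq_cvg; apply: filterS nu => t ht; rewrite (logo_eval hg ht ha).
Qed.

Section PolyMaps.
Context (E : tvsType K).
Implicit Types (f g : E -> A).
Local Notation pmap := (@polymap K B H E A id).

Lemma pmap_cst (x : A) : pmap (fun=> x).
Proof. by move=> a; exists (fun=> (x : A) a) => //; exact: polyfun_cst. Qed.

Lemma pmapD f g : pmap f -> pmap g -> pmap (fun x => f x + g x).
Proof.
move=> pf pg a; have [f' pf' hf] := pf a; have [g' pg' hg'] := pg a.
exists (fun e => f' e + g' e) => [|e]; first exact: polyfun_add.
by rewrite homDE hf hg'.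
Qed.

Lemma pmapZ k f : pmap f -> pmap (fun x => k *: f x).
Proof.
move=> pf a; have [f' pf' hf] := pf a.
exists (fun e => k *: f' e) => [|e]; first exact: polyfun_scale.
by rewrite homZE hf.
Qed.

Lemma pmapB f g : pmap f -> pmap g -> pmap (fun x => f x - g x).
Proof.
move=> pf pg; have -> : (fun x => f x - g x) = (fun x => f x + -1 *: g x).
  by apply/funext => x; rewrite scaleN1r.
exact/pmapD/pmapZ.
Qed.

Lemma pmapM f g : pmap f -> pmap g -> pmap (fun x => f x * g x).
Proof.
move=> pf pg a.
pose F b := s2val (cid2 (pf b)); pose G b := s2val (cid2 (pg b)).
have pF b : polyfun (F b) by rewrite /F; case: cid2.
have hF b (e : nat -> E) : f (e 0%N) b = F b e by rewrite /F; case: cid2.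
have pG b : polyfun (G b) by rewrite /G; case: cid2.
have hG b (e : nat -> E) : g (e 0%N) b = G b e by rewrite /G; case: cid2.
exists (fun e => \sum_(p <- trepr (comul H a)) F p.1 e * G p.2 e) => [|e].
  by apply: polyfun_sum => p; exact: polyfun_mul.
by rewrite homME /tlift /tsum; apply: eq_bigr => p _; rewrite hF hG.
Qed.

Lemma pmapX f n : pmap f -> pmap (fun x => f x ^+ n).
Proof.
move=> pf; elim: n => [|n ih]; first exact: pmap_cst.
have -> : (fun x => f x ^+ n.+1) = (fun x => f x * f x ^+ n).
  by apply/funext => x; rewrite exprS.
exact: pmapM.
Qed.

Lemma pmap_expo f : pmap f -> (forall x, filt 1 (f x)) -> pmap (fun x => expo (f x)).
Proof.
move=> pf hf a; have [n ha] := deg_lt_ex hg a.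
pose F k := s2val (cid2 (pmapX k pf a)).
have pF k : polyfun (F k) by rewrite /F; case: cid2.
have hF k (e : nat -> E) : (f (e 0%N) ^+ k : A) a = F k e by rewrite /F; case: cid2.
exists (fun e => \sum_(k < n) (k`!%:R : K)^-1 *: F k e) => [|e].
  by apply: polyfun_sum => k; exact: polyfun_scale.
by rewrite (expo_eval hg (hf _) ha); apply: eq_bigr => k _; rewrite -hF.
Qed.

Lemma pmap_logt n f : pmap f -> (forall x, filt 1 (f x - 1)) -> pmap (fun x => logt n (f x)).
Proof.
move=> pf hf; elim: n => [|n ih]; first exact: pmap_cst.
apply: pmapD => //; apply: pmapB => //; apply: pmap_expo => // x.
by have [] := logtP hg n (hf x).
Qed.

Lemma pmap_logo f : pmap f -> (forall x, filt 1 (f x - 1)) -> pmap (fun x => logo (f x)).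
Proof.
move=> pf hf a; have [n ha] := deg_lt_ex hg a.
have [g pg hg'] := pmap_logt n pf hf a; exists g => // e.
by rewrite (logo_eval hg (hf _) ha).
Qed.

Lemma pmap_precomp f (s : H -> H) (hs : forall x, linear (fun a => f x (s a))) :
  pmap f -> pmap (fun x => mkHom (hs x)).
Proof. by move=> pf a; have [g pg hg'] := pf (s a); exists g. Qed.

End PolyMaps.

Lemma pmap_inf_val (E : tvsType K) (l : E -> infSpace) : linear l -> continuous l ->
  @polymap K B H E A id (fun x => inf_val (l x)).
Proof.
move=> ll lc a; exists (fun e => inf_val (l (e 0%N)) a) => //.
apply: (polyfun_lin (l := fun x => inf_val (l x) a)).
  move=> k x y; rewrite ll.
  by rewrite /inf_val sub_val_linear homDE homZE.
move=> x; apply: (@continuous_comp _ _ _ l (fun y => inf_val y a : B)); first exact: lc.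
exact: (emb_cont inf_embedding).
Qed.

End Filtered.

End ConvolutionLimits.

Lemma pairDZ (K : pzRingType) (U V : lmodType K) (a b : U) (c d : V) (h : K) :
  (a, c) + h *: (b, d) = (a + h *: b, c + h *: d).
Proof. by []. Qed.

(** * Derivatives of curves of linear maps *)

Section CongruentCurves.
Context (K : numFieldType) (E E' F : tvsType K).
Variables (f : E -> F) (g : E' -> F) (x v : E) (y w : E').
Hypothesis fg : forall h : K, f (x + h *: v) = g (y + h *: w).

Let quotientE : (fun h : K^o => (h : K)^-1 *: (f (x + h *: v) - f x)) =
  (fun h : K^o => (h : K)^-1 *: (g (y + h *: w) - g y)).
Proof.
apply/funext => h; rewrite fg; congr (_ *: (_ - _)).
by have := fg 0; rewrite !scale0r !addr0.
Qed.

Lemma is_dderiv_congr l : is_dderiv f x v l = is_dderiv g y w l.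
Proof. by rewrite /is_dderiv quotientE. Qed.

Lemma dderiv_congr : dderiv f v x = dderiv g w y.
Proof. by rewrite /dderiv; congr (xget 0 _); apply/funext => l; exact: is_dderiv_congr. Qed.

End CongruentCurves.

Section PointwiseDerivatives.
Context (K : numFieldType) (H : hopfAlgType K) (B : comCiaType K).
Local Notation A := (homSpace H B).
Implicit Types (u v : K -> A) (l m x : A).

Definition pwderiv u l := forall a, cderiv (fun h => u h a) (l a).

Lemma eq_pwderiv u v l m : u =1 v -> l = m -> pwderiv u l -> pwderiv v m.
Proof. by move=> /funext -> ->. Qed.

Lemma pwderiv_cst x : pwderiv (fun=> x) 0.
Proof. by move=> a; exact: cderiv_cst. Qed.

Lemma pwderivM u v l m : pwderiv u l -> pwderiv v m ->
  pwderiv (fun h => u h * v h) (l * v 0 + u 0 * m).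
Proof.
move=> hu hv a; rewrite homDE !homME /tlift /tsum -big_split /=.
by apply: cderiv_sum => p; exact: cderivM.
Qed.

Lemma pwderivMl x v m : pwderiv v m -> pwderiv (fun h => x * v h) (x * m).
Proof. by move=> hv; have := pwderivM (pwderiv_cst x) hv; rewrite mul0r add0r. Qed.

Lemma pwderivMr x u l : pwderiv u l -> pwderiv (fun h => u h * x) (l * x).
Proof. by move=> hu; have := pwderivM hu (pwderiv_cst x); rewrite mulr0 addr0. Qed.

Lemma pwderivD u v l m : pwderiv u l -> pwderiv v m -> pwderiv (fun h => u h + v h) (l + m).
Proof. by move=> hu hv a; exact: cderivD. Qed.

(** The derivative of the n-th power at x in direction l, for a product that need
    not be commutative. *)
Fixpoint dpow n x l : A := if n is m.+1 then l * x ^+ m + x * dpow m x l else 0.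

Lemma pwderivX u l n : pwderiv u l -> pwderiv (fun h => u h ^+ n) (dpow n (u 0) l).
Proof.
move=> hu; elim: n => [|n ih]; first exact: pwderiv_cst.
have -> : (fun h => u h ^+ n.+1) = (fun h => u h * u h ^+ n).
  by apply/funext => h; rewrite exprS.
exact: pwderivM.
Qed.

Lemma pwderiv_dpow x u l n : pwderiv u l -> pwderiv (fun h => dpow n x (u h)) (dpow n x l).
Proof.
move=> hu; elim: n => [|n ih]; first exact: pwderiv_cst.
by apply: pwderivD; [exact: pwderivMr|exact: pwderivMl].
Qed.

Lemma dpowZ k x l n : dpow n.+1 (k *: x) l = k ^+ n *: dpow n.+1 x l.
Proof.
elim: n => [|n ih]; first by rewrite /= !mulr0 !expr0 scale1r.
rewrite [LHS]/= -/(dpow n.+1 (k *: x) l) ih homXZ -homZAl -!homZAr scalerA -exprS.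
by rewrite -scalerDr.
Qed.

(** The difference quotient of h q(h) at 0 is q(h) itself. *)
Lemma cderiv_hscale (q : K -> B) (l : B) : cderiv q l -> cderiv (fun h => h *: q h) (q 0).
Proof.
move=> hq; apply: cvg_trans (cderiv_cont hq).
apply: near_eq_cvg; near=> h.
rewrite scale0r subr0 scalerA mulVf ?scale1r //.
by near: h; exact: nbhs_dnbhs_neq.
Unshelve. all: by end_near. Qed.

Lemma cderiv_expscale (q : K -> B) (l : B) n : cderiv q l ->
  cderiv (fun h => h ^+ n *: q h) (if n is 0 then l else if n is 1 then q 0 else 0).
Proof.
move=> hq.
have h1 : cderiv (fun h => h *: q h) (q 0) by exact: cderiv_hscale hq.
case: n => [|n]; first by under eq_fun do rewrite expr0 scale1r.
elim: n => [|n ih]; first by under eq_fun do rewrite expr1.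
have -> : (fun h => h ^+ n.+2 *: q h) = (fun h => h *: (h ^+ n.+1 *: q h)).
  by apply/funext => h; rewrite exprS scalerA.
by have := cderiv_hscale ih; rewrite exprS mul0r scale0r.
Qed.

End PointwiseDerivatives.

(** * The Lie group of characters *)

Section LieGroup.
Context (K : numFieldType) (H : hopfAlgType K) (Hn : nat -> set H).
Context (hg : hopf_grading Hn) (hfin : finite_dim (Hn 0%N)) (B : comCiaType K).
Local Notation A := (homSpace H B).
Local Notation G := (charGroup H B).
Local Notation E := (infSpace H B).
Local Notation filt := (@filt K H Hn B).
Local Notation expo := (@expo K H Hn B).
Local Notation logo := (@logo K H Hn B).
Local Notation vl := (@char_val K H B).
Local Notation iv := (@inf_val K H B).
Local Notation inv g := (vl (char_inv g)).
Local Notation gone := (char_one H B).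
Implicit Types (g p : G) (x y v w : E).

Lemma char_valP g : characters (vl g). Proof. exact: (set_mem (valP g)). Qed.
Lemma char_val_inj : injective vl. Proof. exact: val_inj. Qed.
Lemma char_valM g (h : G) : vl (char_mul g h) = vl g * vl h. Proof. by []. Qed.
Lemma char_val1 : vl gone = 1. Proof. by []. Qed.

Lemma char_mulVl g : inv g * vl g = 1.
Proof.
have [gM g1] := char_valP g; apply: homP => a; rewrite homME hom1E.
transitivity (vl g (counit H a *: 1)); last by rewrite linearZ /= g1.
rewrite -antipodel tlift_comp; last exact: hom_linear.
by apply: eq_tlift => u w; rewrite gM.
Qed.

Lemma char_mulVr g : vl g * inv g = 1.
Proof.
have [gM g1] := char_valP g; apply: homP => a; rewrite homME hom1E.
transitivity (vl g (counit H a *: 1)); last by rewrite linearZ /= g1.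
rewrite -antipoder tlift_comp; last exact: hom_linear.
by apply: eq_tlift => u w; rewrite gM.
Qed.

Lemma char_continuous : continuous vl.
Proof. exact: (@initial_continuous G A set_val). Qed.

Lemma char_eval_continuous a : continuous (fun g : G => vl g a : B).
Proof.
move=> g; apply: (@continuous_comp _ _ _ vl (fun f : A => f a : B)).
  exact: char_continuous.
exact: hom_eval_continuous.
Qed.

Lemma char_cvg (S : set_system G) (g : G) : Filter S ->
  (forall a, (fun h : G => vl h a : B) @ S --> vl g a) -> S --> g.
Proof.
move=> FS h; have hv : vl @ S --> vl g by apply/hom_cvgP.
move=> U [_ [[Q oQ <-] Qx] QU]; apply: filterS QU _.
by apply: hv; exact: open_nbhs_nbhs.
Qed.

(** The determinant of char_det_filt1 depends continuously on phi and equals 1 at the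
    counit, so it is a unit of B near the counit. *)
Lemma char_near_one :
  \forall phi \near nbhs (1 : A), characters phi -> filt 1 (phi - 1).
Proof.
have [B0|B1] := eqVneq (1 : B) 0.
  by apply: nearW => phi _ m a _ _; exact: trivial_target.
have [d [t [r [r0 ht hspan]]]] := aug_generators hg hfin B1.
have hdet : (fun phi : A => \det (1%:M - \matrix_(i, j) phi (r i j)) : B) @ nbhs (1 : A) -->
    (\det (1%:M - \matrix_(i, j) (1 : A) (r i j)) : B).
  apply: cvg_detB => i j; rewrite !mxE; under eq_fun do rewrite !mxE.
  apply: cvg_addB; first exact: cvg_cst.
  rewrite -scaleN1r; under eq_fun do rewrite -scaleN1r.
  apply: (cvg_scaleB (s := fun=> _)); first exact: cvg_cst.
  exact: hom_eval_continuous.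
have det1 : \det (1%:M - \matrix_(i, j) (1 : A) (r i j)) = 1 :> B.
  rewrite (_ : \matrix_(i, j) _ = 0) ?subr0 ?det1 //.
  by apply/matrixP => i j; rewrite !mxE hom1E r0 scale0r.
rewrite det1 in hdet.
have u1 : nbhs (1 : B) (@ring_units B).
  by apply: open_nbhs_nbhs; split; [exact: cia_units_open|exists 1; rewrite mulr1].
apply: (@filterS _ _ (nbhs_filter (1 : A)) _ _ _ (hdet _ u1)) => phi hphi cphi.
exact: char_det_filt1 ht hspan cphi hphi.
Qed.

Lemma inf_filt1 x : filt 1 (iv x).
Proof. exact: (inf_char_filt1 hg hfin (inf_valP x)). Qed.

Lemma expo_inf_char x : characters (expo (iv x)).
Proof. exact: (expo_char hg (inf_filt1 x) (inf_valP x)). Qed.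

Definition char_exp x : G := exist _ (expo (iv x)) (mem_set (expo_inf_char x)).

Lemma char_expE x : vl (char_exp x) = expo (iv x). Proof. by []. Qed.

(** A total function with values in the model space; it is meaningful on characters
    in 1 + F_1, where it is the inverse of the exponential. *)
Definition inf_log (phi : A) : E := xget 0 [set x | expo (iv x) = phi].

Lemma inf_logK phi : characters phi -> filt 1 (phi - 1) -> expo (iv (inf_log phi)) = phi.
Proof.
move=> cphi hphi.
have hl : inf_characters (logo phi).
  apply: (char_expo_inf hg); first exact: logo_filt1.
  by rewrite logoK.
have : [set x | expo (iv x) = phi] (mkSub (inf_characters_subspace H B) hl).
  by rewrite /= /inf_val mkSubK logoK.
by move=> hx; exact: (@xgetPex _ 0 _ (ex_intro _ _ hx)).
Qed.

Lemma inf_logE phi : characters phi -> filt 1 (phi - 1) -> iv (inf_log phi) = logo phi.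
Proof.
move=> cphi hphi; apply: (expo_inj hg); [exact: inf_filt1|exact: logo_filt1|].
by rewrite inf_logK // logoK.
Qed.

Lemma inf_log_exp x : inf_log (expo (iv x)) = x.
Proof.
apply: sub_val_inj; apply: (expo_inj hg); try exact: inf_filt1.
by rewrite inf_logK //; [exact: expo_inf_char|exact: (expo_filt1 hg (inf_filt1 x))].
Qed.

(** The coset of g modulo the open subgroup of the characters in 1 + F_1. *)
Definition char_dom g : set G := [set p | filt 1 (inv g * vl p - 1)].

Definition char_chart g : chart G E :=
  Chart (char_dom g) setT (fun p => inf_log (inv g * vl p)) (fun x => char_mul g (char_exp x)).

(** A coset is open at p because multiplication by the inverse of p moves p to the
    identity, near which char_near_one applies. *)
Lemma char_dom_open g : open (char_dom g).
Proof.
rewrite openE => p hp.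
have c1 : (fun q : G => (inv p * vl q : A)) @ nbhs p --> (1 : A).
  rewrite -(char_mulVl p); apply/hom_cvgP => a; apply: conv_cvg => b.
    exact: cvg_cst.
  exact: char_eval_continuous.
apply: (@filterS _ _ (nbhs_filter p) _ _ _ (c1 _ char_near_one)) => q hq.
rewrite /char_dom /=.
have -> : inv g * vl q - 1 = inv g * vl p * (inv p * vl q - 1) + (inv g * vl p - 1).
  by rewrite mulrBr mulr1 addrA subrK mulrA -(mulrA (inv g)) char_mulVr mulr1.
apply: filtD => //; apply/(filtMl hg)/hq.
rewrite -char_valM; exact: char_valP.
Qed.

Lemma char_chart_is_chart g : is_chart (char_chart g).
Proof.
have inv_dom x : char_dom g (char_mul g (char_exp x)).
  by rewrite /char_dom /= mulrA char_mulVl mul1r; exact: (expo_filt1 hg (inf_filt1 x)).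
split => /=.
- by split; [exact: char_dom_open|exact: openT].
- by split.
- split=> [p /set_mem hp|x _].
    apply: char_val_inj; rewrite char_valM char_expE inf_logK //.
      by rewrite mulrA char_mulVr mul1r.
    by rewrite -char_valM; exact: char_valP.
  by rewrite mulrA char_mulVl mul1r inf_log_exp.
- apply/subspace_continuousP => p hp.
  apply: (emb_cvg (inf_embedding H B)) => a.
  have hl : (fun q : G => logo (inv g * vl q) a) @ within (char_dom g) (nbhs p) -->
      logo (inv g * vl p) a.
    apply: (logo_cvg hg) => //; first exact: withinT.
    apply: conv_cvg => b; first exact: cvg_cst.
    by apply: cvg_within_filter; exact: char_eval_continuous.
  rewrite inf_logE //; last by rewrite -char_valM; exact: char_valP.
  apply: cvg_trans hl; apply: (@near_eq_cvg _ _ _ _ (fun q : G => logo (inv g * vl q) a)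
    (fun q : G => iv (inf_log (inv g * vl q)) a)).
  apply: filterS (@withinT _ (nbhs p) (char_dom g) _) => q hq.
  by rewrite inf_logE //; rewrite -char_valM; exact: char_valP.
- apply: continuous_subspaceT => x.
  apply: (@char_cvg _ _ (fmap_filter _ (nbhs_filter x))) => a.
  apply: conv_cvg => b; first exact: cvg_cst.
  apply: (expo_cvg hg); [by apply: nearW => y; exact: inf_filt1|exact: inf_filt1|].
  by move=> c; exact: (@emb_cont _ _ _ _ _ (inf_embedding H B) c x).
Qed.

(** Local representatives of the group operations all have this shape.  As f is
    constant modulo F_1, their domain is empty or everything, and in the latter
    case they are polynomial. *)
Lemma smooth_log_rep (E' : tvsType K) (U : set E') (f : E' -> A) (k : G) :
  @polymap K B H E' A id f -> (forall z, characters (f z)) ->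
  (forall z z', filt 1 (f z - f z')) -> U = [set z | filt 1 (inv k * f z - 1)] ->
  smooth_on U (fun z => inf_log (inv k * f z)).
Proof.
move=> pf cf ff UE.
have [U0|/set0P[z0 Uz0]] := eqVneq U set0; first by rewrite U0; exact: smooth_on0.
have hz z : filt 1 (inv k * f z - 1).
  have -> : inv k * f z - 1 = inv k * (f z - f z0) + (inv k * f z0 - 1).
    by rewrite mulrBr addrA subrK.
  by apply: filtD; [exact: (filtMl hg)|move: Uz0; rewrite UE].
have -> : U = setT by rewrite UE; apply/seteqP; split => // z _; exact: hz.
apply: (polymap_smooth (inf_embedding H B)) => a.
have [q pq hq] := pmap_logo hg (pmapM (@pmap_cst K H B E' (inv k)) pf) hz a.
exists q => // e; rewrite inf_logE ?hq //; exact: (conv_characters (char_valP _)).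
Qed.

Lemma pmap_exp (E' : tvsType K) (l : E' -> E) : linear l -> continuous l ->
  @polymap K B H E' A id (fun z => expo (iv (l z))).
Proof.
by move=> ll lc; apply: (pmap_expo hg) => [|z]; [exact: pmap_inf_val|exact: inf_filt1].
Qed.

Lemma pmap_exp_id : @polymap K B H E A id (fun x => expo (iv x)).
Proof. by apply: (pmap_exp (l := idfun)) => // x; exact: cvg_id. Qed.

Lemma filt_exp_const x y : filt 1 (expo (iv x) - expo (iv y)).
Proof.
apply: (filt_trans (y := 1)); first exact: (expo_filt1 hg (inf_filt1 x)).
by rewrite -opprB; apply/filtN/(expo_filt1 hg (inf_filt1 y)).
Qed.

Lemma filtM_const (a b a' b' : A) : filt 1 (a - a') -> filt 1 (b - b') ->
  filt 1 (a * b - a' * b').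
Proof.
move=> ha hb; have -> : a * b - a' * b' = (a - a') * b + a' * (b - b').
  by rewrite mulrBl mulrBr addrA subrK.
by apply: filtD; [exact: (filtMr hg)|exact: (filtMl hg)].
Qed.

(** The coset of the identity gets a single chart, the one centred at the identity:
    then the tangent space at the identity has to be studied in one chart only. *)
Definition char_atlas : set (chart G E) :=
  [set c | exists g, (g = gone \/ ~ filt 1 (vl g - 1)) /\ c = char_chart g].

Lemma char_atlas_smooth : smooth_atlas char_atlas.
Proof.
split.
- by move=> _ [g [_ ->]]; exact: char_chart_is_chart.
- move=> p; have [hp|hp] := pselect (filt 1 (vl p - 1)).
    exists (char_chart gone); first by exists gone; split=> //; left.
    have i1 : inv gone = 1 by rewrite -[LHS]mulr1 -[in LHS]char_val1 char_mulVl.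
    by rewrite /= /char_dom /= i1 mul1r.
  exists (char_chart p); first by exists p; split=> //; right.
  by rewrite /= /char_dom /= char_mulVl subrr; exact: filt0.
- move=> _ _ [g [_ ->]] [k [_ ->]].
  apply: (@smooth_log_rep E _ (fun x => vl g * expo (iv x)) k).
  + by apply: pmapM; [exact: pmap_cst|exact: pmap_exp_id].
  + by move=> x; exact: (conv_characters (char_valP _) (expo_inf_char _)).
  + move=> x y; apply: filtM_const; first by rewrite subrr; exact: filt0.
    exact: filt_exp_const.
  + by apply/seteqP; split => [x []|x hx].
Qed.

Lemma char_mul_smooth : smooth_map (prod_atlas char_atlas char_atlas) char_atlas
  (fun p : G * G => char_mul p.1 p.2).
Proof.
split.
  move=> p; apply: (@char_cvg _ _ (fmap_filter _ (nbhs_filter p))) => a.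
  apply: conv_cvg => b.
    apply: (@cvg_comp _ _ _ _ (fun q : G => vl q b : B) _ (nbhs p.1)); first exact: cvg_fst.
    exact: char_eval_continuous.
  apply: (@cvg_comp _ _ _ _ (fun q : G => vl q b : B) _ (nbhs p.2)); first exact: cvg_snd.
  exact: char_eval_continuous.
move=> _ _ [_ [_ [[g [_ ->]] [h [_ ->]] ->]]] [k [_ ->]].
apply: (@smooth_log_rep (E * E)%type _
  (fun z => (vl g * expo (iv z.1)) * (vl h * expo (iv z.2))) k).
- apply: pmapM; apply: pmapM; try exact: pmap_cst.
    by apply: (pmap_exp (l := fst)) => // z; exact: cvg_fst.
  by apply: (pmap_exp (l := snd)) => // z; exact: cvg_snd.
- by move=> z; apply: conv_characters; apply: (conv_characters (char_valP _) (expo_inf_char _)).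
- move=> z z'; apply: filtM_const; apply: filtM_const; try exact: filt_exp_const;
  by rewrite subrr; exact: filt0.
- by apply/seteqP; split => [z []|z hz].
Qed.

Lemma char_inv_smooth : smooth_map char_atlas char_atlas (@char_inv K H B).
Proof.
split.
  move=> p; apply: (@char_cvg _ _ (fmap_filter _ (nbhs_filter p))) => a.
  exact: (char_eval_continuous (a := antipode H a)).
move=> _ _ [g [_ ->]] [k [_ ->]].
apply: (@smooth_log_rep E _ (fun x => inv (char_mul g (char_exp x))) k).
- apply: pmap_precomp.
  by apply: pmapM; [exact: pmap_cst|exact: pmap_exp_id].
- by move=> x; exact: char_valP.
- move=> x y; pose a := char_mul g (char_exp x); pose b := char_mul g (char_exp y).
  have -> : inv a - inv b = inv a * (vl b - vl a) * inv b.
    by rewrite mulrBr char_mulVl mulrBl mul1r -mulrA char_mulVr mulr1.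
  apply: (filtMr hg); apply: (filtMl hg); apply: filtM_const.
    by rewrite subrr; exact: filt0.
  exact: filt_exp_const.
- by apply/seteqP; split => [x []|x hx].
Qed.

Lemma char_lie_group : is_lie_group (@char_mul K H B) gone (@char_inv K H B) char_atlas.
Proof.
split.
- split.
  + by move=> g h k; apply: char_val_inj; exact: convA.
  + by move=> g; apply: char_val_inj; exact: conv1l.
  + by move=> g; apply: char_val_inj; exact: char_mulVl.
- split; first exact: (emb_hausdorff (inf_embedding H B)).
  apply: (hausdorff_separated (f := fun a (g : G) => vl g a : B)).
    exact: char_eval_continuous.
  by move=> g h e; apply: char_val_inj; exact: homP.
- exact: char_atlas_smooth.
- exact: char_mul_smooth.
- exact: char_inv_smooth.
Qed.


Lemma inv_one : inv gone = 1.
Proof. by rewrite -[LHS]mulr1 -[in LHS]char_val1 char_mulVl. Qed.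

Lemma iv0 : iv 0 = 0. Proof. by []. Qed.
Lemma ivZ k x : iv (k *: x) = k *: iv x. Proof. by []. Qed.
Lemma ivB x y : iv (x - y) = iv x - iv y.
Proof. by rewrite /inf_val (linB (@sub_val_linear _ _ _ _)). Qed.

(** Any other chart is centred outside the subgroup of the characters in 1 + F_1, and
    its domain is the coset of its centre. *)
Lemma one_chart c : char_atlas c -> chart_dom c gone -> c = char_chart gone.
Proof.
move=> [g [[-> //|ng] ->]]; rewrite /= /char_dom /= char_val1 mulr1 => hi.
exfalso; apply: ng; have -> : vl g - 1 = - (vl g * (inv g - 1)).
  by rewrite mulrBr char_mulVr mulr1 opprB.
exact/filtN/(filtMl hg).
Qed.

Lemma chart_one : chart_fun (char_chart gone) gone = 0.
Proof.
rewrite /= inv_one char_val1 mulr1; have := inf_log_exp 0.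
by rewrite iv0 (expo0 hg).
Qed.

(** The chain rule for exp, whose differential at x is the series of the dpow k x
    divided by k!. *)
Lemma cderiv_expo (u : K -> A) (x l : A) n a : (forall h, filt 1 (u h)) -> u 0 = x ->
  pwderiv u l -> deg_lt Hn n a -> cderiv (fun h => expo (u h) a)
    (\sum_(k < n) (k`!%:R : K)^-1 *: dpow k x l a).
Proof.
move=> hu <- ul ha.
have -> : (fun h => expo (u h) a) =
    (fun h => \sum_(k < n) (k`!%:R : K)^-1 *: (u h ^+ k : A) a).
  by apply/funext => h; rewrite (expo_eval hg (hu h) ha).
by apply: cderiv_sum => k; apply: cderivZ; exact: pwderivX.
Qed.

Lemma deg_lt_big a m : exists2 n, (m <= n)%N & deg_lt Hn n a.
Proof.
have [n ha] := deg_lt_ex hg a; exists (m + n)%N; first exact: leq_addr.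
exact: deg_lt_le hg _ _ _ (leq_addl _ _) ha.
Qed.

Lemma pwderiv_expo0 v : pwderiv (fun h => expo (h *: iv v)) (iv v).
Proof.
move=> a; have [[|[|n]] // _ ha] := deg_lt_big a 2.
have hv : pwderiv (fun h => h *: iv v) (iv v).
  move=> b; apply: eq_cderiv (@cderiv_affine K B 0 (iv v b)) => // h.
  by rewrite add0r homZE.
apply: eq_cderiv (cderiv_expo (fun h => filtZ h (inf_filt1 v)) (scale0r _) hv ha) => //.
rewrite 2!big_ord_recl big1 ?addr0 => [|k _].
  rewrite /= mulr1 mulr0 addr0 hom0E scaler0 add0r.
  by rewrite factE invr1 scale1r.
rewrite !lift0; have := dpowZ 0 0 (iv v) k.+1.
by rewrite scaler0 exprS mul0r scale0r => ->; rewrite hom0E scaler0.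
Qed.

Lemma dexp_char_val g v : is_dderiv (fun x => vl (char_mul g (char_exp x))) 0 v (vl g * iv v).
Proof.
apply/(is_dderiv_pointwise (hom_embedding B H)).
apply: eq_pwderiv (pwderivMl (x := vl g) (@pwderiv_expo0 v)) => // h.
by rewrite add0r char_valM char_expE ivZ.
Qed.

Lemma tangent_char_val v : tangent_map (char_chart gone) vl gone v = iv v.
Proof.
rewrite /tangent_map chart_one -[RHS]mul1r -char_val1.
exact: (dderivE (emb_hausdorff (hom_embedding B H)) (@dexp_char_val gone v)).
Qed.

Local Notation chart_prod z := ((vl gone * expo (iv z.1)) * (vl gone * expo (iv z.2))).

(** The group law in the logarithmic chart, where the Baker-Campbell-Hausdorff series
    would appear. *)
Definition log_mul (z : E * E) : E := inf_log (inv gone * chart_prod z).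

Lemma chart_prod_char (z : E * E) : characters (inv gone * chart_prod z).
Proof.
apply: (conv_characters (char_valP _)).
by apply: conv_characters; apply: (conv_characters (char_valP _) (expo_inf_char _)).
Qed.

Lemma chart_prod_filt1 (z : E * E) : filt 1 (inv gone * chart_prod z - 1).
Proof.
rewrite inv_one char_val1 !mul1r -[X in _ - X]mulr1.
by apply: filtM_const; apply: (expo_filt1 hg); exact: inf_filt1.
Qed.

Lemma log_mul_smooth : smooth_on setT log_mul.
Proof.
apply: (@smooth_log_rep (E * E)%type _ (fun z => chart_prod z) gone).
- apply: pmapM; apply: pmapM; try exact: pmap_cst.
    by apply: (pmap_exp (l := fst)) => // z; exact: cvg_fst.
  by apply: (pmap_exp (l := snd)) => // z; exact: cvg_snd.
- by move=> z; apply: conv_characters; apply: (conv_characters (char_valP _) (expo_inf_char _)).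
- move=> z z'; apply: filtM_const; apply: filtM_const; try exact: filt_exp_const;
  by rewrite subrr; exact: filt0.
- by apply/seteqP; split => // z _; exact: chart_prod_filt1.
Qed.

Lemma expo_log_mul x y : expo (iv (log_mul (x, y))) = expo (iv x) * expo (iv y).
Proof.
rewrite /log_mul inf_logK; [|exact: chart_prod_char|exact: chart_prod_filt1].
by rewrite inv_one char_val1 !mul1r.
Qed.

Local Notation livf w := (left_invariant_vf (@char_mul K H B) gone (char_chart gone) w).

(** As a partial derivative of the smooth map log_mul, a left-invariant vector field
    is differentiable itself. *)
Lemma livfE w x : livf w x = dderiv log_mul (0, w) (x, 0).
Proof.
rewrite /left_invariant_vf chart_one; apply: dderiv_congr => h.
by rewrite pairDZ scaler0 addr0.
Qed.

Local Opaque log_mul left_invariant_vf.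

Lemma livf_deriv w x :
  pwderiv (fun h => iv (log_mul (x, h *: w))) (iv (livf w x)).
Proof.
have [_ hd _] := log_mul_smooth; have [l hl] := hd [::] (x, 0) (0, w) I.
have {}hl : is_dderiv log_mul (x, 0) (0, w) l := hl.
rewrite livfE (dderivE (emb_hausdorff (inf_embedding H B)) hl).
have h1 := (is_dderiv_pointwise (inf_embedding H B) _ _ _ _).1 hl.
have h2 : pwderiv (fun h => iv (log_mul ((x, 0) + h *: (0, w)))) (iv l) := h1.
apply: (eq_pwderiv _ erefl h2) => h.
by rewrite pairDZ scaler0 addr0 add0r.
Qed.

Lemma log_mul_unit x w : iv (log_mul (x, 0 *: w)) = iv x.
Proof.
apply: (@expo_inj _ _ _ hg); [exact: inf_filt1|exact: inf_filt1|].
by rewrite expo_log_mul scale0r iv0 (expo0 hg) mulr1.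
Qed.

(** The differential of exp at x sends the left-invariant field of w to exp x * w:
    differentiate exp (log_mul (x, h w)) = exp x * exp (h w) at h = 0. *)
Lemma livf_dexp w x n a : deg_lt Hn n a ->
  \sum_(k < n) (k`!%:R : K)^-1 *: dpow k (iv x) (iv (livf w x)) a =
  (expo (iv x) * iv w : A) a.
Proof.
move=> ha.
have h1 := @cderiv_expo (fun h => iv (log_mul (x, h *: w))) _ _ n a
  (fun h => inf_filt1 _) (log_mul_unit x w) (@livf_deriv w x) ha.
have h2 : cderiv (fun h => expo (iv (log_mul (x, h *: w))) a) ((expo (iv x) * iv w : A) a).
  apply: (eq_cderiv _ erefl (@pwderivMl _ _ _ (expo (iv x)) _ _ (@pwderiv_expo0 w) a)) => h.
  by rewrite expo_log_mul ivZ.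
exact: (cderiv_uniq h1 h2).
Qed.

Lemma livf0 w : livf w 0 = w.
Proof.
apply: sub_val_inj; apply: homP => a; have [[|[|n]] // _ ha] := deg_lt_big a 2.
have := livf_dexp w 0 ha; rewrite iv0 (expo0 hg) mul1r => <-.
rewrite 2!big_ord_recl big1 ?addr0 => [|k _].
  rewrite /= mulr1 mulr0 addr0 hom0E scaler0 add0r.
  by rewrite factE invr1 scale1r.
rewrite !lift0; have := dpowZ 0 0 (iv (livf w 0)) k.+1.
by rewrite scaler0 exprS mul0r scale0r => ->; rewrite hom0E scaler0.
Qed.

Lemma livf_is_dderiv w v : is_dderiv (fun x => livf w x) 0 v (dderiv (fun x => livf w x) v 0).
Proof.
have [_ hd _] := log_mul_smooth; have [l hl] := hd [:: (0, w)] (0, 0) (v, 0) I.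
have e (h : K) : livf w (0 + h *: v) = dderiv log_mul (0, w) ((0, 0) + h *: (v, 0)).
  by rewrite livfE pairDZ scaler0 addr0.
rewrite -/(iter_dderiv log_mul [:: (0, w)]) in hl.
have hl' : is_dderiv (fun x => livf w x) 0 v l by rewrite (is_dderiv_congr e).
by rewrite (dderivE (emb_hausdorff (inf_embedding H B)) hl').
Qed.

(** Differentiate livf_dexp along x = s v at s = 0.  In its left hand side, the term
    of index k carries a factor s^(k-1), so only the indices 1 and 2 contribute:
    the first gives the unknown derivative, the second half the anticommutator. *)
Lemma livf_dderiv w v : iv (dderiv (fun x => livf w x) v 0) =
  iv v * iv w - 2^-1 *: (iv w * iv v + iv v * iv w).
Proof.
set Z := dderiv _ v 0.
have hY : pwderiv (fun s => iv (livf w (s *: v))) (iv Z).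
  have h1 := (is_dderiv_pointwise (inf_embedding H B) _ _ _ _).1 (@livf_is_dderiv w v).
  have h2 : pwderiv (fun h => iv (livf w (0 + h *: v))) (iv Z) := h1.
  by apply: (eq_pwderiv _ erefl h2) => h; rewrite add0r.
(* A degree bound of at least 3 makes the indices 0, 1 and 2 explicit. *)
apply: homP => a; have [[|[|[|n]]] // _ ha] := deg_lt_big a 3.
have hR : cderiv (fun s => (expo (s *: iv v) * iv w : A) a) ((iv v * iv w : A) a).
  exact: pwderivMr (@pwderiv_expo0 v) a.
(* D k is the derivative at s = 0 of the k-th term, without the factor 1/k!. *)
pose D (k : nat) : B := if k is j.+1 then
   (if j is 0 then dpow 1 (iv v) (iv Z) a else if j is 1 then dpow 2 (iv v) (iv w) a else 0)
   else 0.
have hL : cderiv (fun s => (expo (s *: iv v) * iv w : A) a)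
    (\sum_(k < n.+3) (k`!%:R : K)^-1 *: D k).
  have -> : (fun s => (expo (s *: iv v) * iv w : A) a) = (fun s =>
      \sum_(k < n.+3) (k`!%:R : K)^-1 *: dpow k (s *: iv v) (iv (livf w (s *: v))) a).
    by apply/funext => s; rewrite -(livf_dexp w (s *: v) ha) ivZ.
  apply: cderiv_sum => -[[|k] kn]; apply: cderivZ; first exact: cderiv_cst.
  have := cderiv_expscale (n := k) (@pwderiv_dpow _ _ _ (iv v) _ _ k.+1 hY a).
  rewrite scale0r livf0.
  have -> : (fun h => h ^+ k *: (dpow k.+1 (iv v) (iv (livf w (h *: v))) : A) a) =
     (fun h => (dpow k.+1 (h *: iv v) (iv (livf w (h *: v))) : A) a).
    by apply/funext => h; rewrite dpowZ homZE.
  by case: k kn => [|[|k]] kn.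
have := cderiv_uniq hR hL; rewrite 3!big_ord_recl big1 ?addr0 => [|k _]; last first.
  by rewrite /bump /= scaler0.
rewrite /bump /= !mulr1 !mulr0 !addr0 scaler0 add0r !expr1 !factE /= invr1 scale1r => e.
by rewrite homBE e homZE addrK.
Qed.

Lemma char_lie_bracket v w :
  iv (lie_bracket (@char_mul K H B) gone (char_chart gone) v w) = conv_bracket (iv v) (iv w).
Proof.
transitivity (iv (dderiv (fun x => livf w x) v 0) - iv (dderiv (fun x => livf v x) w 0)).
  rewrite -ivB /lie_bracket /vf_bracket chart_one.
  have e a b : a = v -> b = w -> iv (dderiv (fun x => livf w x) a 0 -
      dderiv (fun x => livf v x) b 0) = iv (dderiv (fun x => livf w x) v 0 -
      dderiv (fun x => livf v x) w 0) by move=> -> ->.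
  exact: (e _ _ (livf0 v) (livf0 w)).
apply: (etrans (congr2 (fun a b : A => a - b) (livf_dderiv w v) (livf_dderiv v w))).
by rewrite opprB addrA [iv w * iv v + _]addrC subrK.
Qed.

Lemma char_lie_algebra : lie_algebra_via (@char_mul K H B) gone char_atlas vl
  (@inf_characters K H B) (@conv_bracket K H B).
Proof.
split.
  split; first exact: char_continuous.
  move=> _ _ [g [_ ->]] ->.
  rewrite (_ : local_dom _ _ _ = setT); last by apply/seteqP; split.
  apply: (polymap_smooth (hom_embedding B H)).
  by apply: pmapM; [exact: pmap_cst|exact: pmap_exp_id].
move=> c /one_chart h /h -> T.
have TE : T = iv by apply/funext => v; exact: tangent_char_val.
rewrite TE; split.
- exact: sub_val_linear.
- split.
  + by move=> v _; exact: inf_valP.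
  + by move=> v w _ _; exact: sub_val_inj.
  + by move=> x hx; exists (mkSub (inf_characters_subspace H B) hx).
- move=> U; split; first by move=> [W oW <-]; exists W.
  by move=> [W oW ->]; exists W.
- by move=> v w; exact: char_lie_bracket.
Qed.

End LieGroup.

Theorem theoremA (R : realType) (K : numFieldType)
    (hK : K = (R : numFieldType) \/ K = (R[i]%C : numFieldType))
    (H : hopfAlgType K) (Hn : nat -> set H)
    (hgraded : hopf_grading Hn)
    (hfin : finite_dim (Hn 0%N))
    (B : comCiaType K) :
  exists (E : tvsType K) (At : set (chart (charGroup H B) E)),
    is_lie_group (@char_mul K H B) (@char_one K H B) (@char_inv K H B) At /\
    lie_algebra_via (@char_mul K H B) (@char_one K H B) At
      (@char_val K H B) (@inf_characters K H B) (@conv_bracket K H B).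
Proof.
exists (infSpace H B), (@char_atlas _ _ _ hgraded hfin B).
by split; [exact: char_lie_group|exact: char_lie_algebra].
Qed.
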